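(* Let $F$ be a number field, $\mathcal{O}\subseteq\mathcal{O}_F$ an order and $I \subseteq \mathcal{O}$ a nonzero ideal. Then \[ \mathrm{Gal}(H_{I,\mathcal{O}}/H_\mathcal{O}) \cong \frac{(\mathcal{O}/I)^\times}{\pi_I^\times(\mathcal{O}^\times)}, \] where $\pi_I^\times\colon \mathcal{O}^\times \to (\mathcal{O}/I)^\times$ is the map induced by the projection $\pi_I\colon\mathcal{O}\twoheadrightarrow\mathcal{O}/I$.
   Context: For a rational prime $p$, $\mathcal{O}_p := \mathcal{O}\otimes_\mathbb{Z}\mathbb{Z}_p \subseteq F_p := F\otimes_\mathbb{Q}\mathbb{Q}_p$, and an idele $s \in \mathbb{A}_F^\times \cong (\mathbb{A}_\mathbb{Q}\otimes_\mathbb{Q}F)^\times$ has $p$-components $s_p \in F_p^\times$. For a nonzero ideal $J\subseteq\mathcal{O}$ set $U_{J,\mathcal{O}} := \{ s \in \mathbb{A}_F^\times : s_p \in \mathcal{O}_p^\times\cap(1+J\mathcal{O}_p) \text{ for all rational primes } p\}$ and $H_{J,\mathcal{O}} := (F^{\mathrm{ab}})^{[U_{J,\mathcal{O}},F]}$, where $[\cdot,F]$ is the global Artin map. The ring class field is $H_\mathcal{O} := H_{\mathcal{O},\mathcal{O}}$ (i.e. $J=\mathcal{O}$). *)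

(* Defs.v *)
From HB Require Import structures.
From mathcomp Require Import all_boot all_order all_algebra all_field.
From mathcomp Require Import all_classical all_reals topology normedtype.
From mathcomp Require Import ring.

Set Implicit Arguments.
Unset Strict Implicit.
Unset Printing Implicit Defensive.

Import Order.TTheory GRing.Theory Num.Theory.
Import numFieldNormedType.Exports.

Local Open Scope classical_set_scope.
Local Open Scope ring_scope.

HB.mixin Record isConjClosed (G : groupType) (S : {pred G}) := {
  gpredJ : forall x y : G, x \in S -> (x ^ y)%g \in S
}.
#[short(type="normalClosed")]
HB.structure Definition NormalClosed (G : groupType) :=
  {S of GroupClosed G S & isConjClosed G S}.

Section QuotientGroup.
Local Open Scope group_scope.
Local Open Scope quotient_scope.
Variables (G : groupType) (N : normalClosed G).

Definition cosetg_rel (x y : G) := x * y^-1 \in N.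

Lemma cosetg_equiv : equiv_class_of cosetg_rel.
Proof.
rewrite /cosetg_rel; split=> [x|x y|y x z].
- by rewrite mulgV gpred1.
- by rewrite -(gpredV N) invgM invgK.
- move=> xy yz; have := gpredM _ _ xy yz.
  by rewrite mulgA mulgVK.
Qed.
Canonical cosetg_equiv_rel := EquivRelPack cosetg_equiv.
Canonical cosetg_encModRel := defaultEncModRel cosetg_rel.

Definition quotg := {eq_quot cosetg_rel}.
HB.instance Definition _ : EqQuotient G cosetg_rel quotg := EqQuotient.on quotg.
HB.instance Definition _ := Choice.on quotg.
Definition quotg_one : quotg := \pi_quotg (1 : G).
Definition quotg_mul (a b : quotg) : quotg := \pi_quotg (repr a * repr b).
Definition quotg_inv (a : quotg) : quotg := \pi_quotg (repr a)^-1.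

Lemma quotg_eqP x y : reflect (\pi_quotg x = \pi_quotg y) (x * y^-1 \in N).
Proof. apply: (iffP idP) => [h|/eqP]; [apply/eqP|]; by rewrite piE. Qed.

Lemma quotg_reprP x : exists2 n, n \in N & repr (\pi_quotg x) = n * x.
Proof.
exists (repr (\pi_quotg x) * x^-1); last by rewrite mulgVK.
by apply/quotg_eqP; rewrite reprK.
Qed.

Lemma quotg_piM x y : quotg_mul (\pi_quotg x) (\pi_quotg y) = \pi_quotg (x * y).
Proof.
apply/quotg_eqP; case: (quotg_reprP x) => n nN ->.
case: (quotg_reprP y) => m mN ->.
have -> : n * x * (m * y) * (x * y)^-1 = n * (m ^ x^-1).
  by rewrite conjgE invgK invgM !mulgA mulgK.
by rewrite gpredM // gpredJ.
Qed.

Lemma quotg_piV x : quotg_inv (\pi_quotg x) = \pi_quotg x^-1.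
Proof.
apply/quotg_eqP; case: (quotg_reprP x) => n nN ->.
have -> : (n * x)^-1 * x^-1^-1 = n^-1 ^ x by rewrite conjgE invgM invgK !mulgA.
by rewrite gpredJ // gpredV.
Qed.

Lemma quotg_mulA : associative quotg_mul.
Proof.
elim/quotW=> x; elim/quotW=> y; elim/quotW=> z.
by rewrite (quotg_piM y z) (quotg_piM x y) !quotg_piM mulgA.
Qed.
Lemma quotg_mul1 : left_id quotg_one quotg_mul.
Proof. by elim/quotW=> x; rewrite quotg_piM mul1g. Qed.
Lemma quotg_mul1r : right_id quotg_one quotg_mul.
Proof. by elim/quotW=> x; rewrite quotg_piM mulg1. Qed.
Lemma quotg_mulV : left_inverse quotg_one quotg_inv quotg_mul.
Proof. by elim/quotW=> x; rewrite quotg_piV quotg_piM mulVg. Qed.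
Lemma quotg_mulVr : right_inverse quotg_one quotg_inv quotg_mul.
Proof. by elim/quotW=> x; rewrite quotg_piV quotg_piM mulgV. Qed.

HB.instance Definition _ := isGroup.Build quotg
  quotg_mulA quotg_mul1 quotg_mul1r quotg_mulV quotg_mulVr.
End QuotientGroup.

Record units (R : comPzRingType) := Units {
  uval : R;
  uinv : R;
  uvalV : uval * uinv = 1
}.

Section Units.
Variable R : comPzRingType.

HB.instance Definition _ := gen_eqMixin (units R).
HB.instance Definition _ := gen_choiceMixin (units R).

Lemma uval_inj : injective (@uval R).
Proof.
move=> [x y xy] [x' y' xy'] /= exx; rewrite -exx in xy' *.
have eyy : y = y' by rewrite -[y]mul1r -xy' -mulrA (mulrC y') mulrA xy mul1r.
by rewrite -eyy in xy' *; congr Units; exact: Prop_irrelevance.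
Qed.

Definition unit_one : units R := Units (mulr1 1).
Lemma unit_mul_proof (u v : units R) :
  (uval u * uval v) * (uinv u * uinv v) = 1.
Proof. by rewrite mulrACA !uvalV mulr1. Qed.
Definition unit_mul u v := Units (unit_mul_proof u v).
Lemma unit_inv_proof (u : units R) : uinv u * uval u = 1.
Proof. by rewrite mulrC uvalV. Qed.
Definition unit_inv u := Units (unit_inv_proof u).

Lemma unit_mulA : associative unit_mul.
Proof. by move=> u v w; apply: uval_inj; rewrite /= mulrA. Qed.
Lemma unit_mul1 : left_id unit_one unit_mul.
Proof. by move=> u; apply: uval_inj; rewrite /= mul1r. Qed.
Lemma unit_mul1r : right_id unit_one unit_mul.
Proof. by move=> u; apply: uval_inj; rewrite /= mulr1. Qed.
Lemma unit_mulV : left_inverse unit_one unit_inv unit_mul.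
Proof. by move=> u; apply: uval_inj; rewrite /= unit_inv_proof. Qed.
Lemma unit_mulVr : right_inverse unit_one unit_inv unit_mul.
Proof. by move=> u; apply: uval_inj; rewrite /= uvalV. Qed.

HB.instance Definition _ := isGroup.Build (units R)
  unit_mulA unit_mul1 unit_mul1r unit_mulV unit_mulVr.
End Units.

Section UnitsMap.
Variables (R S : comPzRingType) (f : {rmorphism R -> S}).

Lemma units_map_proof (u : units R) : f (uval u) * f (uinv u) = 1.
Proof. by rewrite -rmorphM uvalV rmorph1. Qed.
Definition units_map u := Units (units_map_proof u).

Definition units_image : {pred units S} :=
  fun v => `[< exists u, units_map u = v >].

Lemma units_imageM : mulg_closed units_image.
Proof.
move=> _ _ /asboolP[u <-] /asboolP[v <-]; apply/asboolP; exists (u * v)%g.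
by apply: uval_inj; rewrite /= rmorphM.
Qed.
Lemma units_image1 : (1 : units S)%g \in units_image.
Proof. by apply/asboolP; exists 1%g; apply: uval_inj; rewrite /= rmorph1. Qed.
Lemma units_imageV : invg_closed units_image.
Proof.
move=> _ /asboolP[u <-]; apply/asboolP; exists (u^-1)%g.
exact: uval_inj.
Qed.
Lemma units_imageJ (x y : units S) :
  x \in units_image -> (x ^ y)%g \in units_image.
Proof.
suff -> : (x ^ y)%g = x by [].
by apply: uval_inj; rewrite /= mulrC -mulrA uvalV mulr1.
Qed.
HB.instance Definition _ := isMulClosed.Build (units S) units_image units_imageM.
HB.instance Definition _ := isMul1Closed.Build (units S) units_image units_image1.
HB.instance Definition _ := isInvClosed.Build (units S) units_image units_imageV.
HB.instance Definition _ := isConjClosed.Build (units S) units_image units_imageJ.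
End UnitsMap.

Definition isomorphic (G H : groupType) :=
  exists2 f : G -> H, {morph f : x y / (x * y)%g} & bijective f.

(* Unlike idealr of ring_quotient, an ideal may be the whole ring. *)
HB.mixin Record isIdealClosed (R : comPzRingType) (S : {pred R}) := {
  ideal_mull : forall a x : R, x \in S -> a * x \in S
}.
#[short(type="ideal")]
HB.structure Definition Ideal (R : comPzRingType) :=
  {S of GRing.ZmodClosed R S & isIdealClosed R S}.

Section QuotientRing.
Local Open Scope quotient_scope.
Variables (R : comPzRingType) (I : ideal R).

Definition quotr := Quotient.quot I.
HB.instance Definition _ := GRing.Zmodule.on quotr.

Definition quotr_pi (x : R) : quotr := \pi_(Quotient.quot I) x.

Definition quotr_one : quotr := quotr_pi 1.
Definition quotr_mul (a b : quotr) : quotr :=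
  quotr_pi (repr (a : Quotient.quot I) * repr (b : Quotient.quot I)).

Lemma quotr_eqP x y : reflect (quotr_pi x = quotr_pi y) (x - y \in I).
Proof. by rewrite Quotient.idealrBE; apply: eqP. Qed.

Lemma quotr_piB x y : quotr_pi (x - y) = quotr_pi x - quotr_pi y.
Proof. exact: (raddfB \pi_(Quotient.quot I)). Qed.
Lemma quotr_piD x y : quotr_pi (x + y) = quotr_pi x + quotr_pi y.
Proof. exact: (raddfD \pi_(Quotient.quot I)). Qed.

Lemma quotr_reprP x :
  exists2 i, i \in I & repr (quotr_pi x : Quotient.quot I) = x + i.
Proof.
exists (repr (quotr_pi x : Quotient.quot I) - x); last by rewrite addrC subrK.
by apply/quotr_eqP; rewrite /quotr_pi reprK.
Qed.

Lemma quotr_piM x y : quotr_mul (quotr_pi x) (quotr_pi y) = quotr_pi (x * y).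
Proof.
apply/quotr_eqP; case: (quotr_reprP x) => i iI ->.
case: (quotr_reprP y) => j jI ->.
have -> : (x + i) * (y + j) - x * y = (x + i) * j + y * i by ring.
by rewrite rpredD // ideal_mull.
Qed.

Lemma quotrW (P : quotr -> Prop) : (forall x, P (quotr_pi x)) -> forall a, P a.
Proof. by move=> Ppi a; rewrite -(reprK (a : Quotient.quot I)); apply: Ppi. Qed.

Lemma quotr_mulA : associative quotr_mul.
Proof.
elim/quotrW=> x; elim/quotrW=> y; elim/quotrW=> z.
by rewrite (quotr_piM y z) (quotr_piM x y) !quotr_piM mulrA.
Qed.
Lemma quotr_mulC : commutative quotr_mul.
Proof. by elim/quotrW=> x; elim/quotrW=> y; rewrite !quotr_piM mulrC. Qed.
Lemma quotr_mul1 : left_id quotr_one quotr_mul.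
Proof. by elim/quotrW=> x; rewrite quotr_piM mul1r. Qed.
Lemma quotr_mulD : left_distributive quotr_mul +%R.
Proof.
elim/quotrW=> x; elim/quotrW=> y; elim/quotrW=> z.
by rewrite -quotr_piD !quotr_piM mulrDl quotr_piD.
Qed.

HB.instance Definition _ := GRing.Zmodule_isComPzRing.Build quotr
  quotr_mulA quotr_mulC quotr_mul1 quotr_mulD.

Lemma quotr_pi_monoid : monoid_morphism quotr_pi.
Proof. by split=> // x y; rewrite -quotr_piM. Qed.
HB.instance Definition _ := GRing.isZmodMorphism.Build R quotr quotr_pi quotr_piB.
HB.instance Definition _ :=
  GRing.isMonoidMorphism.Build R quotr quotr_pi quotr_pi_monoid.
End QuotientRing.

Section FullIdeal.
Variable R : comPzRingType.
Definition full_ideal : {pred R} := fun _ => true.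
Lemma full_ideal_zmod : zmod_closed full_ideal. Proof. by []. Qed.
Lemma full_ideal_mull (a x : R) : x \in full_ideal -> a * x \in full_ideal.
Proof. by []. Qed.
HB.instance Definition _ := GRing.isZmodClosed.Build R full_ideal full_ideal_zmod.
HB.instance Definition _ := isIdealClosed.Build R full_ideal full_ideal_mull.
End FullIdeal.
Arguments full_ideal : clear implicits.

Definition rational_prime := {p : nat | prime p}.

Section Padic.
Variable p : rational_prime.

(* pdvd k x means that x lies in p ^ k Z_(p), i.e. |x|_p <= p ^ - k *)
Definition pdvd (k : nat) (x : rat) := exists a b : int,
  ~~ (sval p %| b)%Z /\ x = (sval p)%:R ^+ k * (a%:~R / b%:~R).

Lemma p_gt0 : (0 < sval p)%N. Proof. exact: prime_gt0 (valP p). Qed.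

Lemma pN1 : ~~ (sval p %| 1)%Z.
Proof. by rewrite dvdz1 absz_nat gtn_eqF // prime_gt1 // (valP p). Qed.

Lemma pNM (b c : int) : ~~ (sval p %| b)%Z -> ~~ (sval p %| c)%Z ->
  ~~ (sval p %| b * c)%Z.
Proof.
by rewrite !dvdzE !absz_nat abszM Euclid_dvdM ?negb_or ?(valP p) // => -> ->.
Qed.

Lemma pN_neq0 (b : int) : ~~ (sval p %| b)%Z -> (b%:~R : rat) != 0.
Proof. by apply: contra; rewrite intr_eq0 => /eqP->; rewrite dvdz0. Qed.

Lemma pdvd0 k : pdvd k 0.
Proof. by exists 0, 1; rewrite pN1 mul0r mulr0. Qed.

Lemma pdvdB k x y : pdvd k x -> pdvd k y -> pdvd k (x - y).
Proof.
move=> [a [b [pb ->]]] [c [d [pd ->]]].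
exists (a * d - c * b), (b * d); split; first exact: pNM.
rewrite intrB !intrM; field.
by rewrite (pN_neq0 pb) (pN_neq0 pd).
Qed.

Lemma pdvdM j k x y : pdvd j x -> pdvd k y -> pdvd (j + k) (x * y).
Proof.
move=> [a [b [pb ->]]] [c [d [pd ->]]].
exists (a * c), (b * d); split; first exact: pNM.
rewrite !intrM exprD; field.
by rewrite (pN_neq0 pb) (pN_neq0 pd).
Qed.

Lemma pdvdW j k x : (j <= k)%N -> pdvd k x -> pdvd j x.
Proof.
move=> jk [a [b [pb ->]]]; exists ((sval p)%:R ^+ (k - j) * a), b; split=> //.
rewrite intrM rmorphXn /= rmorph_nat -{1}(subnKC jk) exprD; ring.
Qed.

Lemma pdvd_int k (z : int) : pdvd k ((sval p)%:R ^+ k * z%:~R).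
Proof. by exists z, 1; rewrite pN1 divr1. Qed.

Lemma pdvd_bounded x : exists j, pdvd 0 ((sval p)%:R ^+ j * x).
Proof.
have [b0 xE] : denq x != 0 /\ x = (numq x)%:~R / (denq x)%:~R.
  by rewrite divq_num_den denq_neq0.
have d0 : (0 < `|denq x|)%N by rewrite absz_gt0.
have [c cp dE] := pfactor_coprime (valP p) d0.
case: c cp dE => [|c] cp dE; first by move: d0; rewrite dE.
set j := logn _ _ in dE; exists j, (numq x), c.+1%:Z; split.
  by rewrite dvdzE !absz_nat -prime_coprime // (valP p).
rewrite expr0 mul1r {1}xE -(gez0_abs (ltW (denq_gt0 x))) dE.
have p0 : ((sval p)%:R : rat) != 0 by rewrite pnatr_eq0 -lt0n p_gt0.
rewrite PoszM intrM -!pmulrn natrX; field.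
by rewrite nat1r pnatr_eq0 expf_neq0.
Qed.

Definition padic_cauchy : {pred nat -> rat} := fun u => `[< forall k,
  exists N, forall m n, (N <= m)%N -> (N <= n)%N -> pdvd k (u m - u n) >].

Lemma padic_cauchy_bounded u : u \in padic_cauchy ->
  exists j N, forall n, (N <= n)%N -> pdvd 0 ((sval p)%:R ^+ j * u n).
Proof.
move=> /asboolP /(_ 0%N) [N uN]; have [j pj] := pdvd_bounded (u N).
exists j, N => n Nn.
have -> : (sval p)%:R ^+ j * u n = (sval p)%:R ^+ j * u N -
  (sval p)%:R ^+ j * (u N - u n) by ring.
apply: pdvdB => //; rewrite -[0%N]addn0; apply: pdvdM; last exact: uN.
by apply: (@pdvdW _ j) => //; rewrite -[X in pdvd _ X]mulr1; apply: (pdvd_int j 1).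
Qed.

Lemma pdvd_shift k j x y : pdvd 0 ((sval p)%:R ^+ j * x) -> pdvd (k + j) y ->
  pdvd k (x * y).
Proof.
move=> [a [b [pb xE]]] [c [d [pd ->]]].
exists (a * c), (b * d); split; first exact: pNM.
set w := c%:~R / _; have -> : x * ((sval p)%:R ^+ (k + j) * w) =
  (sval p)%:R ^+ k * ((sval p)%:R ^+ j * x) * w by rewrite exprD; ring.
rewrite xE !intrM /w; field.
by rewrite (pN_neq0 pb) (pN_neq0 pd).
Qed.

Lemma padic_cauchy_subring : subring_closed padic_cauchy.
Proof.
split.
- apply/asboolP => k; exists 0%N => m n _ _.
  by rewrite /GRing.one /= subrr; exact: pdvd0.
- move=> u v /asboolP uC /asboolP vC; apply/asboolP => k.
  have [[M uM] [N vN]] := (uC k, vC k); exists (maxn M N) => m n.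
  rewrite !geq_max => /andP[Mm Nm] /andP[Mn Nn].
  rewrite !fctE.
  have -> : u m - v m - (u n - v n) = (u m - u n) - (v m - v n) by ring.
  by apply: pdvdB; [apply: uM|apply: vN].
- move=> u v uP vP; have [i [M uM]] := padic_cauchy_bounded uP.
  have [j [N vN]] := padic_cauchy_bounded vP.
  move/asboolP in uP; move/asboolP in vP; apply/asboolP => k.
  have [M' uM'] := uP (k + j)%N; have [N' vN'] := vP (k + i)%N.
  exists (maxn (maxn M N) (maxn M' N')) => m n.
  rewrite !geq_max => /andP[/andP[Mm Nm] /andP[Mm' Nm']].
  move=> /andP[/andP[Mn Nn] /andP[Mn' Nn']].
  rewrite !fctE.
  have -> : u m * v m - u n * v n = u m * (v m - v n) - v n * (u n - u m).
    by ring.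
  apply: pdvdB; [apply: (pdvd_shift (uM m Mm))|apply: (pdvd_shift (vN n Nn))].
    exact: vN'.
  exact: uM'.
Qed.
HB.instance Definition _ :=
  GRing.isSubringClosed.Build (nat -> rat) padic_cauchy padic_cauchy_subring.

Definition cauchy_seq := {u : nat -> rat | u \in padic_cauchy}.
HB.instance Definition _ := SubChoice.on cauchy_seq.
HB.instance Definition _ := GRing.SubChoice_isSubComPzRing.Build _ _ cauchy_seq
  padic_cauchy_subring.

Definition padic_null : {pred cauchy_seq} := fun u => `[< forall k,
  exists N, forall n, (N <= n)%N -> pdvd k (val u n) >].

Lemma padic_null_zmod : zmod_closed padic_null.
Proof.
split; first by apply/asboolP => k; exists 0%N => n _; exact: pdvd0.
move=> u v /asboolP uC /asboolP vC; apply/asboolP => k.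
have [[M uM] [N vN]] := (uC k, vC k); exists (maxn M N) => n.
rewrite geq_max => /andP[Mn Nn]; rewrite rmorphB.
by apply: pdvdB; [apply: uM|apply: vN].
Qed.
Lemma padic_null_mull (a u : cauchy_seq) :
  u \in padic_null -> a * u \in padic_null.
Proof.
move=> /asboolP uC; apply/asboolP => k.
have [j [N aN]] := padic_cauchy_bounded (valP a).
have [M uM] := uC (k + j)%N; exists (maxn M N) => n.
rewrite geq_max => /andP[Mn Nn]; rewrite rmorphM.
by apply: (pdvd_shift (aN n Nn)); apply: uM.
Qed.
HB.instance Definition _ :=
  GRing.isZmodClosed.Build cauchy_seq padic_null padic_null_zmod.
HB.instance Definition _ :=
  isIdealClosed.Build cauchy_seq padic_null padic_null_mull.

(* Q_p, as the completion of Q *)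
Definition padic := quotr padic_null.
HB.instance Definition _ := GRing.ComPzRing.on padic.

(* Z_p, as the closure of Z in Q_p *)
Definition padic_int : set padic :=
  [set quotr_pi padic_null u | u in [set u : cauchy_seq |
    forall n, val u n \is a Num.int]].

Lemma const_cauchy (x : rat) : (fun _ : nat => x) \in padic_cauchy.
Proof. by apply/asboolP => k; exists 0%N => *; rewrite subrr; exact: pdvd0. Qed.
Definition padic_of_rat (x : rat) : padic :=
  quotr_pi padic_null (Sub (fun _ => x) (const_cauchy x)).

Lemma padic_of_rat_zmod : zmod_morphism padic_of_rat.
Proof.
by move=> x y; rewrite /padic_of_rat -rmorphB; congr quotr_pi; apply: val_inj.
Qed.
Lemma padic_of_rat_monoid : monoid_morphism padic_of_rat.
Proof.
split; first by rewrite -(rmorph1 (quotr_pi padic_null)); congr quotr_pi;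
  apply: val_inj.
by move=> x y; rewrite /padic_of_rat -rmorphM; congr quotr_pi; apply: val_inj.
Qed.
HB.instance Definition _ :=
  GRing.isZmodMorphism.Build rat padic padic_of_rat padic_of_rat_zmod.
HB.instance Definition _ :=
  GRing.isMonoidMorphism.Build rat padic padic_of_rat padic_of_rat_monoid.
End Padic.

(* F tensor_Q K, where K is a Q-algebra through f; the row vector v stands for
   \sum_i e_i (x) v_i, with e the reference basis vbasis of F over Q. *)
Definition tensor (F : fieldExtType rat) (K : comPzRingType)
  (f : {rmorphism rat -> K}) := 'rV[K]_(\dim {:F}).

Section ScalarExtension.
Variables (F : fieldExtType rat) (K : comPzRingType) (f : {rmorphism rat -> K}).
Local Notation n := (\dim {:F}).
Local Notation e := (vbasis {:F}).

Local Notation T := (tensor F f).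
HB.instance Definition _ := GRing.Zmodule.on T.

Definition tensor_of (x : F) (a : K) : T := \row_i (f (coord e i x) * a).

Definition tensor_mul (v w : T) : T :=
  \sum_(i < n) \sum_(j < n) tensor_of (e`_i * e`_j) (v 0 i * w 0 j).

Lemma tensor_ofDl x y a : tensor_of (x + y) a = tensor_of x a + tensor_of y a.
Proof. by apply/rowP => i; rewrite !mxE linearD rmorphD mulrDl. Qed.
Lemma tensor_ofDr x a b : tensor_of x (a + b) = tensor_of x a + tensor_of x b.
Proof. by apply/rowP => i; rewrite !mxE mulrDr. Qed.
Lemma tensor_of0l a : tensor_of 0 a = 0.
Proof. by apply/rowP => i; rewrite !mxE linear0 rmorph0 mul0r. Qed.
Lemma tensor_of0r x : tensor_of x 0 = 0.
Proof. by apply/rowP => i; rewrite !mxE mulr0. Qed.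
Lemma tensor_of_suml I (r : seq I) (P : pred I) (x : I -> F) a :
  tensor_of (\sum_(i <- r | P i) x i) a = \sum_(i <- r | P i) tensor_of (x i) a.
Proof.
exact: (big_morph (tensor_of^~ a) (fun x y => tensor_ofDl x y a) (tensor_of0l a)).
Qed.
Lemma tensor_of_sumr I (r : seq I) (P : pred I) x (a : I -> K) :
  tensor_of x (\sum_(i <- r | P i) a i) = \sum_(i <- r | P i) tensor_of x (a i).
Proof. exact: (big_morph (tensor_of x) (tensor_ofDr x) (tensor_of0r x)). Qed.
Lemma tensor_ofZ q x a : tensor_of (q *: x) a = tensor_of x (f q * a).
Proof.
apply/rowP => i; rewrite !mxE linearZ /= rmorphM.
by rewrite mulrA (mulrC (f q)).
Qed.

Lemma tensorE (v : T) : v = \sum_(i < n) tensor_of e`_i (v 0 i).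
Proof.
apply/rowP => j; rewrite summxE (bigD1 j) //= big1 ?addr0.
  by rewrite mxE coord_free ?(basis_free (vbasisP _)) // eqxx rmorph1 mul1r.
move=> i ij; rewrite mxE coord_free ?(basis_free (vbasisP _)) //.
by rewrite (negPf ij) rmorph0 mul0r.
Qed.

Lemma tensor_ind (P : T -> Prop) : P 0 ->
  (forall v w, P v -> P w -> P (v + w)) ->
  (forall x a, P (tensor_of x a)) -> forall v, P v.
Proof. by move=> P0 PD Pof v; rewrite [v]tensorE; apply: (big_ind P). Qed.

Lemma tensor_mulDl : left_distributive tensor_mul +%R.
Proof.
move=> u v w; rewrite /tensor_mul -big_split; apply: eq_bigr => i _ /=.
rewrite -big_split; apply: eq_bigr => j _ /=.
by rewrite mxE mulrDl tensor_ofDr.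
Qed.

Lemma tensor_mulC : commutative tensor_mul.
Proof.
move=> v w; rewrite /tensor_mul exchange_big; apply: eq_bigr => i _ /=.
by apply: eq_bigr => j _; rewrite mulrC (mulrC (v 0 j)).
Qed.

Lemma tensor_mulDr : right_distributive tensor_mul +%R.
Proof. by move=> u v w; rewrite tensor_mulC tensor_mulDl !(tensor_mulC u). Qed.

Lemma tensor_mul0l v : tensor_mul 0 v = 0.
Proof. by apply: (addIr (tensor_mul 0 v)); rewrite -tensor_mulDl !add0r. Qed.

Lemma coord_sumE (x : F) : x = \sum_(i < n) coord e i x *: e`_i.
Proof. exact: coord_vbasis (memvf x). Qed.

Lemma tensor_ofM x y a b :
  tensor_mul (tensor_of x a) (tensor_of y b) = tensor_of (x * y) (a * b).
Proof.
rewrite {2}[x]coord_sumE mulr_suml tensor_of_suml /tensor_mul.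
apply: eq_bigr => i _; rewrite {2}[y]coord_sumE mulr_sumr tensor_of_suml.
apply: eq_bigr => j _; rewrite -scalerAl -scalerAr !tensor_ofZ !mxE.
by congr tensor_of; ring.
Qed.

Lemma tensor_mulA : associative tensor_mul.
Proof.
move=> u v w; elim/tensor_ind: u => [|u u' IHu IHu'|x a].
- by rewrite !tensor_mul0l.
- by rewrite !tensor_mulDl IHu IHu'.
elim/tensor_ind: v => [|v v' IHv IHv'|y b].
- by rewrite (tensor_mulC _ 0) !tensor_mul0l (tensor_mulC _ 0) tensor_mul0l.
- by rewrite !(tensor_mulDl, tensor_mulDr) IHv IHv'.
elim/tensor_ind: w => [|w w' IHw IHw'|z c].
- by rewrite !(tensor_mulC _ 0) !tensor_mul0l (tensor_mulC _ 0) tensor_mul0l.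
- by rewrite !tensor_mulDr IHw IHw'.
by rewrite !tensor_ofM !mulrA.
Qed.

Lemma tensor_mul1 : left_id (tensor_of 1 1) tensor_mul.
Proof.
move=> v; elim/tensor_ind: v => [|v w IHv IHw|x a].
- by rewrite tensor_mulC tensor_mul0l.
- by rewrite tensor_mulDr IHv IHw.
by rewrite tensor_ofM !mul1r.
Qed.

HB.instance Definition _ := GRing.Zmodule_isComPzRing.Build T
  tensor_mulA tensor_mulC tensor_mul1 tensor_mulDl.

Definition tensor_inj (x : F) : T := tensor_of x 1.
Lemma tensor_inj_zmod : zmod_morphism tensor_inj.
Proof. by move=> x y; apply/rowP => i; rewrite !mxE linearB rmorphB mulrBl. Qed.
Lemma tensor_inj_monoid : monoid_morphism tensor_inj.
Proof. by split=> // x y; rewrite /tensor_inj -[1 in LHS]mulr1 -tensor_ofM. Qed.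
HB.instance Definition _ :=
  GRing.isZmodMorphism.Build F T tensor_inj tensor_inj_zmod.
HB.instance Definition _ :=
  GRing.isMonoidMorphism.Build F T tensor_inj tensor_inj_monoid.
End ScalarExtension.

Section SubsetAlgebra.
Variable A : comPzRingType.
Implicit Types X Y : set A.

(* the additive subgroup generated by X *)
Definition zspan X : set A := [set z | exists n (v : 'I_n -> A) (c : 'I_n -> int),
  (forall i, X (v i)) /\ z = \sum_i v i *~ c i].

Definition prodset X Y : set A :=
  zspan [set x * y | x in X & y in Y].

(* P ^ k as an ideal of the ring X, so that P ^ 0 = X *)
Definition ideal_pow X P (k : nat) : set A := iter k (prodset P) X.

Definition prime_ideal_of X (P : set A) : Prop :=
  [/\ P `<=` X, P 0, forall x y, P x -> P y -> P (x + y),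
      forall a x, X a -> P x -> P (a * x) & ~ P 1 /\
      forall x y, X x -> X y -> P (x * y) -> P x \/ P y].

Definition residue_card X (P : set A) (q : nat) : Prop :=
  exists r : 'I_q -> A, (forall i, X (r i)) /\
    forall x, X x -> exists! i, P (x - r i).
End SubsetAlgebra.

Definition integers (L : fieldType) : set L :=
  [set x | integralOver (fun z : int => z%:~R) x].

HB.mixin Record isZLattice (F : fieldExtType rat) (S : {pred F}) := {
  lattice_basis : exists2 b : (\dim {:F}).-tuple F, basis_of {:F} b &
    forall x, x \in S <-> exists c : 'I_(\dim {:F}) -> int,
      x = \sum_(i < \dim {:F}) b`_i *~ c i
}.
#[short(type="orderOf")]
HB.structure Definition OrderOf (F : fieldExtType rat) :=
  {S of GRing.SubringClosed F S & isZLattice F S}.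

Definition order_ring (F : fieldExtType rat) (O : orderOf F) :=
  {x : F | x \in (O : {pred F})}.
HB.instance Definition _ F (O : orderOf F) := SubChoice.on (order_ring O).
HB.instance Definition _ F (O : orderOf F) :=
  [SubChoice_isSubComNzRing of order_ring O by <:].

Record gal_group (L : fieldType) (K : set L) := Galois {
  gal_fun :> L -> L;
  gal_inv : L -> L;
  gal_funK : cancel gal_fun gal_inv;
  gal_invK : cancel gal_inv gal_fun;
  gal_funB : zmod_morphism gal_fun;
  gal_funM : monoid_morphism gal_fun;
  gal_fix : forall x, K x -> gal_fun x = x
}.

Section Galois.
Variables (L : fieldType) (K : set L).
Local Notation gal := (gal_group K).

HB.instance Definition _ := gen_eqMixin gal.
HB.instance Definition _ := gen_choiceMixin gal.

Lemma gal_eq (s t : gal) : s =1 t -> s = t.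
Proof.
case: s t => [s s' sK s'K sB sM sF] [t t' tK t'K tB tM tF] /= /funext est.
have est' : s' = t' by apply/funext => x; rewrite -[x in LHS]t'K -est sK.
by subst t t'; congr Galois; exact: Prop_irrelevance.
Qed.

Definition gal_one : gal.
Proof. by apply: (@Galois _ _ id id). Defined.

Definition gal_mul (s t : gal) : gal.
Proof.
apply: (@Galois _ _ (s \o t) (gal_inv t \o gal_inv s)).
- exact: can_comp (gal_funK s) (gal_funK t).
- exact: can_comp (gal_invK t) (gal_invK s).
- by move=> x y; rewrite /= !gal_funB.
- split=> [|x y]; first by rewrite /= !(gal_funM _).1.
  by rewrite /= !(gal_funM _).2.
- by move=> x Kx; rewrite /= !gal_fix.
Defined.

Definition gal_opp (s : gal) : gal.
Proof.
apply: (@Galois _ _ (gal_inv s) s).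
- exact: gal_invK.
- exact: gal_funK.
- by move=> x y; apply: (can_inj (gal_funK s)); rewrite gal_funB !gal_invK.
- split=> [|x y]; apply: (can_inj (gal_funK s)).
    by rewrite gal_invK (gal_funM s).1.
  by rewrite (gal_funM s).2 !gal_invK.
- by move=> x Kx; apply: (can_inj (gal_funK s)); rewrite gal_invK gal_fix.
Defined.

Lemma gal_mulA : associative gal_mul. Proof. by move=> s t u; apply: gal_eq. Qed.
Lemma gal_mul1 : left_id gal_one gal_mul. Proof. by move=> s; apply: gal_eq. Qed.
Lemma gal_mul1r : right_id gal_one gal_mul. Proof. by move=> s; apply: gal_eq. Qed.
Lemma gal_mulV : left_inverse gal_one gal_opp gal_mul.
Proof. by move=> s; apply: gal_eq => x; apply: gal_funK. Qed.
Lemma gal_mulVr : right_inverse gal_one gal_opp gal_mul.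
Proof. by move=> s; apply: gal_eq => x; apply: gal_invK. Qed.
HB.instance Definition _ := isGroup.Build gal
  gal_mulA gal_mul1 gal_mul1r gal_mulV gal_mulVr.

Definition krull_open (W : set gal) : Prop := forall s, W s ->
  exists xs : seq L, forall t : gal, {in xs, s =1 t} -> W t.

Lemma krull_openT : krull_open setT. Proof. by move=> s _; exists [::]. Qed.
Lemma krull_openI : setI_closed krull_open.
Proof.
move=> U V oU oV s [/oU[xs Us] /oV[ys Vs]]; exists (xs ++ ys) => t st.
by split; [apply: Us|apply: Vs] => x xin; apply: st; rewrite mem_cat xin ?orbT.
Qed.
Lemma krull_open_bigU (I : Type) (U : I -> set gal) :
  (forall i, krull_open (U i)) -> krull_open (\bigcup_i U i).
Proof.
by move=> oU s [i _ /oU[xs Us]]; exists xs => t st; exists i => //; exact: Us.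
Qed.
HB.instance Definition _ := isOpenTopological.Build gal
  krull_openT krull_openI krull_open_bigU.

Definition fixed_field (S : set gal) : {pred L} :=
  fun x => `[< forall s, S s -> s x = x >].

Lemma fixed_field_divring (S : set gal) : divring_closed (fixed_field S).
Proof.
split.
- by apply/asboolP => s _; exact: (gal_funM s).1.
- move=> x y /asboolP Sx /asboolP Sy; apply/asboolP => s Ss.
  by rewrite gal_funB Sx ?Sy.
- move=> x y /asboolP Sx /asboolP Sy; apply/asboolP => s Ss.
  pose sM := GRing.isMonoidMorphism.Build L L s (gal_funM s).
  pose sB := GRing.isZmodMorphism.Build L L s (gal_funB s).
  pose sR : {rmorphism L -> L} := HB.pack (s : L -> L) sM sB.
  by have := fmorph_div sR x y; rewrite /= Sx ?Sy.
Qed.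
HB.instance Definition _ (S : set gal) :=
  GRing.isDivringClosed.Build L (fixed_field S) (fixed_field_divring S).

Definition fixed_sub (S : set gal) := {x : L | x \in fixed_field S}.
HB.instance Definition _ (S : set gal) := SubChoice.on (fixed_sub S).
HB.instance Definition _ (S : set gal) :=
  [SubChoice_isSubIntegralDomain of fixed_sub S by <:].
HB.instance Definition _ (S : set gal) :=
  [SubIntegralDomain_isSubField of fixed_sub S by <:].
End Galois.

Section Local.
Variable F : fieldExtType rat.

Definition local_alg (p : rational_prime) := tensor F (padic_of_rat p).
HB.instance Definition _ p := GRing.ComPzRing.on (local_alg p).

(* X (x) Z_p inside F (x) Q_p, for a subgroup X of F *)
Definition localize (p : rational_prime) (X : set F) : set (local_alg p) :=
  zspan [set tensor_of (padic_of_rat p) x a | x in X & a in @padic_int p].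
Arguments localize : clear implicits.

Definition ext_ideal (p : rational_prime) (X J : set F) : set (local_alg p) :=
  prodset [set tensor_inj (padic_of_rat p) j | j in J] (localize p X).
End Local.
Arguments localize {F} p X.
Arguments ext_ideal {F} p X J.

Definition unit_in (A : comPzRingType) (X : set A) (u : units A) : Prop :=
  X (uval u) /\ X (uinv u).

Lemma zspan_mul (A : comPzRingType) (X : set A) x y :
  (forall x y, X x -> X y -> X (x * y)) ->
  zspan X x -> zspan X y -> zspan X (x * y).
Proof.
move=> XM [m [v [c [Xv ->]]]] [n [w [d [Xw ->]]]].
exists #|{: 'I_m * 'I_n}|.
exists (fun k => v (enum_val k).1 * w (enum_val k).2).
exists (fun k => c (enum_val k).1 * d (enum_val k).2).
split=> [k|]; first exact: XM.
rewrite mulr_suml; under eq_bigr do rewrite mulr_sumr.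
rewrite pair_bigA /= (reindex (@enum_val _ {: 'I_m * 'I_n})) /=.
  by apply: eq_bigr => k _; rewrite mulrzAl mulrzAr -mulrzA (mulrC (d _)).
exact/onW_bij/enum_val_bij.
Qed.

Lemma zspan_natmul (A : comPzRingType) (X : set A) x n :
  zspan X x -> zspan X (x *+ n).
Proof.
move=> [m [v [c [Xv ->]]]]; exists m, v, (fun i => c i * n%:Z); split=> //.
rewrite -sumrMnl; apply: eq_bigr => i _.
by rewrite mulrzA pmulrn.
Qed.

Lemma padic_intM p (a b : padic p) :
  padic_int a -> padic_int b -> padic_int (a * b).
Proof.
move=> [u uZ <-] [v vZ <-]; exists (u * v); last by rewrite rmorphM.
by move=> n; rewrite rmorphM /= rpredM ?uZ ?vZ.
Qed.

Section MaximalAbelian.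
Variable F : fieldType.

Definition abelian_extension (L : fieldType) (j : {rmorphism F -> L}) : Prop :=
  [/\ forall x, algebraicOver j x,
      forall x, (forall s : gal_group (range j), s x = x) -> range j x &
      forall s t : gal_group (range j), (s * t)%g = (t * s)%g].

(* j : F -> L presents L as F^ab *)
Definition maximal_abelian (L : fieldType) (j : {rmorphism F -> L}) : Prop :=
  abelian_extension j /\
  forall (M : fieldType) (k : {rmorphism F -> M}), abelian_extension k ->
    exists g : {rmorphism M -> L}, forall x, g (k x) = j x.
End MaximalAbelian.

Section Ideles.
Variables (F : fieldExtType rat) (R : realType).
Local Notation OF := (@integers F).
Local Notation "'OFp' p" := (localize p OF) (at level 10).

Lemma integersM (x y : F) : OF x -> OF y -> OF (x * y).
Proof. exact: (@integral_mul _ _ (intmul (1 : F))). Qed.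
Lemma integers1 : OF 1.
Proof. exact: (@integral1 _ _ (intmul (1 : F))). Qed.

Lemma localizeM p x y : (OFp p) x -> (OFp p) y -> (OFp p) (x * y).
Proof.
apply: zspan_mul => _ _ [x' xO [a aZ <-]] [y' yO [b bZ <-]].
exists (x' * y'); first exact: integersM.
by exists (a * b); [exact: padic_intM|rewrite -tensor_ofM].
Qed.

Lemma localize1 p : (OFp p) 1.
Proof.
exists 1%N, (fun=> 1), (fun=> 1); split=> [_|]; last by rewrite big_ord1.
exists 1; first exact: integers1.
exists 1 => //; exists 1; last by rewrite rmorph1.
by move=> n; rewrite rmorph1 rpred1.
Qed.

Definition arch_alg := tensor F (@ratr R).
HB.instance Definition _ := GRing.ComPzRing.on arch_alg.

Record idele := Idele {
  arch_part : units arch_alg;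
  idele_at : forall p : rational_prime, units (local_alg F p);
  idele_fin : finite_set [set p | ~ unit_in (OFp p) (idele_at p)]
}.

HB.instance Definition _ := gen_eqMixin idele.
HB.instance Definition _ := gen_choiceMixin idele.

Lemma idele_eq s t :
  arch_part s = arch_part t -> (forall p, idele_at s p = idele_at t p) -> s = t.
Proof.
case: s t => [si sp sfin] [ti tp tfin] /= est epst.
have {}epst : sp = tp by exact: functional_extensionality_dep.
by subst ti tp; congr Idele; exact: Prop_irrelevance.
Qed.

Lemma idele_one_fin :
  finite_set [set p | ~ unit_in (OFp p) (1%g : units (local_alg F p))].
Proof.
apply: (sub_finite_set _ (@finite_set0 rational_prime)) => p /=.
by apply; split; exact: localize1.
Qed.
Definition idele_one := @Idele 1%g (fun=> 1%g) idele_one_fin.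

Lemma idele_mul_fin (s t : idele) :
  finite_set [set p | ~ unit_in (OFp p) (idele_at s p * idele_at t p)%g].
Proof.
have stfin : finite_set ([set p | ~ unit_in (OFp p) (idele_at s p)] `|`
  [set p | ~ unit_in (OFp p) (idele_at t p)]).
  by rewrite finite_setU; split; exact: idele_fin.
apply: sub_finite_set stfin => p /=; apply: contra_notP.
move=> /not_orP[/contrapT[sp spV] /contrapT[tp tpV]].
by split; exact: localizeM.
Qed.
Definition idele_mul s t :=
  @Idele (arch_part s * arch_part t)%g (fun p => (idele_at s p * idele_at t p)%g)
    (idele_mul_fin s t).

Lemma idele_inv_fin (s : idele) :
  finite_set [set p | ~ unit_in (OFp p) (idele_at s p)^-1%g].
Proof.
apply: sub_finite_set (idele_fin s) => p /=; apply: contra_not => -[sp spV].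
by split.
Qed.
Definition idele_inv s :=
  @Idele (arch_part s)^-1%g (fun p => (idele_at s p)^-1%g) (idele_inv_fin s).

Lemma idele_mulA : associative idele_mul.
Proof. by move=> s t u; apply: idele_eq => [|p]; exact: mulgA. Qed.
Lemma idele_mul1 : left_id idele_one idele_mul.
Proof. by move=> s; apply: idele_eq => [|p]; exact: mul1g. Qed.
Lemma idele_mul1r : right_id idele_one idele_mul.
Proof. by move=> s; apply: idele_eq => [|p]; exact: mulg1. Qed.
Lemma idele_mulV : left_inverse idele_one idele_inv idele_mul.
Proof. by move=> s; apply: idele_eq => [|p]; exact: mulVg. Qed.
Lemma idele_mulVr : right_inverse idele_one idele_inv idele_mul.
Proof. by move=> s; apply: idele_eq => [|p]; exact: mulgV. Qed.
HB.instance Definition _ := isGroup.Build idele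
  idele_mulA idele_mul1 idele_mul1r idele_mulV idele_mulVr.

(* Basic neighbourhoods of 1 in the restricted product topology, for ps a list
   of primes and W a neighbourhood of 1 in F (x) R. *)
Definition idele_box (ps : seq rational_prime) (k : nat)
    (W : set 'rV[R]_(\dim {:F})) : set idele :=
  [set s | [/\ W (uval (arch_part s)), forall p, unit_in (OFp p) (idele_at s p) &
     {in ps, forall p, exists2 y, (OFp p) y &
       uval (idele_at s p) - 1 = y *+ (sval p ^ k)}]].

Definition idele_open (U : set idele) : Prop := forall s, U s ->
  exists ps k (W : set 'rV[R]_(\dim {:F})),
    nbhs (uval (1%g : units arch_alg) : 'rV[R]_(\dim {:F})) W /\ forall t, idele_box ps k W t -> U (s * t)%g.

Lemma idele_boxS ps qs j k V W : {subset ps <= qs} -> (j <= k)%N -> W `<=` V ->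
  idele_box qs k W `<=` idele_box ps j V.
Proof.
move=> pqs jk WV s [/WV Vs sO sk]; split=> // p /pqs /sk[y yO ->].
exists (y *+ (sval p ^ (k - j))); first exact: zspan_natmul.
by rewrite -mulrnA -expnD subnK.
Qed.

Lemma idele_openT : idele_open setT.
Proof. by move=> s _; exists [::], 0%N, setT; split=> //; exact: filterT. Qed.
Lemma idele_openI : setI_closed idele_open.
Proof.
move=> U V oU oV s [/oU[ps [j [W [W1 Us]]]] /oV[qs [k [X [X1 Vs]]]]].
exists (ps ++ qs), (maxn j k), (W `&` X); split; first exact: filterI.
move=> t st; split; [apply: Us|apply: Vs]; apply: idele_boxS st.
- by move=> p pps; rewrite mem_cat pps.
- exact: leq_maxl.
- exact: subIsetl.
- by move=> p pqs; rewrite mem_cat pqs orbT.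
- exact: leq_maxr.
- exact: subIsetr.
Qed.
Lemma idele_open_bigU (I : Type) (U : I -> set idele) :
  (forall i, idele_open (U i)) -> idele_open (\bigcup_i U i).
Proof.
move=> oU s [i _ /oU[ps [k [W [W1 Us]]]]]; exists ps, k, W; split=> // t st.
by exists i => //; exact: Us.
Qed.
HB.instance Definition _ := isOpenTopological.Build idele
  idele_openT idele_openI idele_open_bigU.

(* Relational, so as not to presuppose that a nonzero x in F is a unit at
   almost all p. *)
Definition principal_idele : set idele := [set s | exists x : units F,
  arch_part s = units_map (tensor_inj (@ratr R)) x /\
  forall p, idele_at s p = units_map (tensor_inj (padic_of_rat p)) x].

(* the identity component of the unit group of F (x) R *)
Definition arch_component : set idele := [set s |
  connected_component [set (uval u : 'rV[R]_(\dim {:F})) | u in [set: units arch_alg]]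
    (uval (1%g : units arch_alg)) (uval (arch_part s)) /\ forall p, idele_at s p = 1%g].

Definition nonzero_prime (P : set F) : Prop :=
  prime_ideal_of OF P /\ exists2 x, P x & x != 0.

(* s is a uniformizer at the completion at P, and 1 at all other places *)
Definition local_uniformizer (P : set F) (s : idele) : Prop :=
  [/\ arch_part s = 1%g,
      forall p, prodset [set uval (idele_at s p)] (OFp p) = ext_ideal p OF P &
      forall Q, nonzero_prime Q -> Q <> P -> forall k p,
        ext_ideal p OF (ideal_pow OF Q k) (uval (idele_at s p) - 1)].

(* U_{J,O}: the first condition says that s_p is a unit of O_p, the second
   that s_p lies in 1 + J O_p. There is no condition at infinity. *)
Definition congruence_ideles (O : orderOf F) (J : ideal (order_ring O)) :
    set idele :=
  let OinF := [set x | x \in (O : {pred F})] in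
  [set s | forall p, unit_in (localize p OinF) (idele_at s p) /\
     ext_ideal p OinF [set val x | x in [set x | x \in J]]
       (uval (idele_at s p) - 1)].

Section ArtinMap.
Variables (Fab : fieldType) (iota : {rmorphism F -> Fab}).

Definition finite_subextension (E : set Fab) : Prop :=
  [/\ range iota `<=` E, forall x y, E x -> E y -> E (x - y) /\ E (x / y) &
      exists n (b : 'I_n -> Fab), forall x, E x ->
        exists c : 'I_n -> F, x = \sum_i iota (c i) * b i].

Definition integers_in (E : set Fab) : set Fab := E `&` @integers Fab.

Definition prime_over (E : set Fab) (P : set F) (Pi : set Fab) : Prop :=
  prime_ideal_of (integers_in E) Pi /\ iota @^-1` Pi = P.

Definition unramified_in (E : set Fab) (P : set F) : Prop :=
  forall Pi, prime_over E P Pi -> ~ (iota @` P `<=` prodset Pi Pi).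

(* The first four conditions, with the arithmetic Frobenius as normalisation,
   characterise the global Artin map. The last three are the reciprocity
   isomorphism it induces, from the quotient of the idele group by the closure
   of principal_idele * arch_component onto Gal (F^ab / F). *)
Record is_artin_map (art : idele -> gal_group (range iota)) : Prop := {
  artM : {morph art : s t / (s * t)%g};
  art_continuous : continuous art;
  art_principal : forall s, principal_idele s -> art s = 1%g;
  art_frobenius : forall (E : set Fab) (P : set F) q s,
    finite_subextension E -> nonzero_prime P -> residue_card OF P q ->
    unramified_in E P -> local_uniformizer P s ->
    forall Pi, prime_over E P Pi ->
    forall x, integers_in E x -> Pi (art s x - x ^+ q);
  art_surj : range art = setT;
  art_open : forall U, open U -> open (art @` U);
  art_ker : [set s | art s = 1%g] = closure
    [set (s * t)%g | s in principal_idele & t in arch_component]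
}.

Variables (art : idele -> gal_group (range iota)) (O : orderOf F).

(* H_{J,O} as a subset of F^ab, and as a field in its own right *)
Definition H_pred (J : ideal (order_ring O)) : {pred Fab} :=
  fixed_field (art @` congruence_ideles J).

Definition H_field (J : ideal (order_ring O)) :=
  fixed_sub (art @` congruence_ideles J).
HB.instance Definition _ J := GRing.Field.on (H_field J).

Definition ring_class_pred : {pred Fab} := H_pred (full_ideal (order_ring O)).

(* Gal (H_{J,O} / H_O) *)
Definition gal_over_ring_class (J : ideal (order_ring O)) : groupType :=
  @gal_group (H_field J) [set x | val x \in ring_class_pred].
End ArtinMap.
End Ideles.

(* Main.v *)
Require Import Defs.
From HB Require Import structures.
From mathcomp Require Import all_boot all_order all_algebra all_field.
From mathcomp Require Import all_classical all_reals topology normedtype.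
From mathcomp Require Import ring zify.

(* [H_O] and [H_{I,O}] are the fixed fields of the images under the Artin map
   [art] of the congruence subgroups [U_I <= U_O] of the ideles, and [art U_I]
   is open. Two surjections with source [U_O] are compared: restriction
   [u |-> art u] onto [Gal (H_{I,O} / H_O)], and the map [U_O -> (O/I)^*]
   reducing all the [u_p] simultaneously, which exists by the Chinese remainder
   theorem. The kernel of the second is [U_I]. As [U_I] is open, [ker art],
   which is a closure, lies in the product of [U_I] with the principal ideles,
   and the principal ideles in [U_O] are those of the units of [O]; so [art u]
   lies in [art U_I] exactly when the residue of [u] comes from [O^*].

   Infinite Galois theory is replaced by one computation: for a group [W] of
   automorphisms and a polynomial [f] with finite orbit under [W], the
   coefficients of the product of the [Y - g], for [g] in the orbit, are fixed
   by [W], so an automorphism [s] that fixes all [W]-invariants maps [f] into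
   its orbit. *)

Set Implicit Arguments.
Unset Strict Implicit.
Unset Printing Implicit Defensive.

Import Order.TTheory GRing.Theory Num.Theory.
Import numFieldNormedType.Exports.

Local Open Scope classical_set_scope.
Local Open Scope ring_scope.

(** * p-adic integers *)

Section Padic.
Variable p : rational_prime.

Lemma prime_rat_neq0 : ((sval p)%:R : rat) != 0.
Proof. by rewrite pnatr_eq0 -lt0n p_gt0. Qed.

Lemma pdvd_intP k (z : int) :
  pdvd p k z%:~R -> exists c : int, z = c * (sval p ^ k)%:Z.
Proof.
move=> [a [b [pb e]]].
have b0 := pN_neq0 pb.
have {}e : z * b = (sval p ^ k)%:Z * a.
  apply: (@intr_inj rat); rewrite !intrM e -pmulrn natrX; field.
  exact: b0.
have : ((sval p ^ k)%:Z %| z * b)%Z by rewrite e dvdz_mulr.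
rewrite Gauss_dvdzl; first by case/dvdzP=> c ->; exists c.
rewrite coprimezE !absz_nat coprimeXl // prime_coprime ?(valP p) //.
Qed.

Lemma pdvdN k x : pdvd p k x -> pdvd p k (- x).
Proof. by move=> h; rewrite -sub0r; apply: pdvdB => //; apply: pdvd0. Qed.

Lemma pdvdD k x y : pdvd p k x -> pdvd p k y -> pdvd p k (x + y).
Proof. by move=> h h'; rewrite -[y]opprK; apply: pdvdB => //; apply: pdvdN. Qed.

Lemma padic_intB (a b : padic p) : padic_int a -> padic_int b -> padic_int (a - b).
Proof.
move=> [u uZ <-] [v vZ <-]; exists (u - v); last by rewrite rmorphB.
by move=> n; rewrite rmorphB /= rpredB ?uZ ?vZ.
Qed.

Lemma padic_int0 : padic_int (0 : padic p).
Proof. by exists 0 => [n|]; rewrite ?rmorph0 // rpred0. Qed.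

Lemma padic_eqP (u v : cauchy_seq p) :
  quotr_pi (@padic_null p) u = quotr_pi (@padic_null p) v <->
  forall k, exists N, forall n, (N <= n)%N -> pdvd p k (val u n - val v n).
Proof.
split=> [/quotr_eqP/asboolP h|h]; last by apply/quotr_eqP/asboolP.
by move=> k; have [N hN] := h k; exists N.
Qed.

Lemma int_inv_mod (b : int) k : ~~ (sval p %| b)%Z ->
  exists c d : int, b * c = 1 + d * (sval p ^ k)%:Z.
Proof.
move=> pb; have : coprimez b (sval p ^ k)%:Z.
  by rewrite coprimezE !absz_nat coprime_sym coprimeXl // prime_coprime ?(valP p).
case/coprimezP=> -[x y] /= e; exists x, (- y).
by rewrite -e; ring.
Qed.

(** Elements of [padic_int] are limits of integers, so [1 / b] with [b] prime to [p] is approached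
    by integers [c k] that invert [b] modulo [p ^ k]. *)
Lemma padic_int_rat q : pdvd p 0 q -> padic_int (padic_of_rat p q).
Proof.
case=> a [b [pb ->]]; rewrite expr0 mul1r rmorphM /=.
have intZ (z : int) : padic_int (padic_of_rat p z%:~R).
  exists (Sub (fun=> z%:~R) (const_cauchy p z%:~R)) => [n|//].
  exact: intr_int.
apply: padic_intM => //.
have /choice [c cE] : forall k, exists c : int,
    exists d : int, b * c = 1 + d * (sval p ^ k)%:Z.
  by move=> k; apply: int_inv_mod.
have b0 := pN_neq0 pb.
have diff k : pdvd p k ((c k)%:~R - (b%:~R)^-1).
  have [d e] := cE k; exists d, b; split=> //.
  have {}e : b%:~R * (c k)%:~R = 1 + d%:~R * (sval p)%:R ^+ k :> rat.
    by rewrite -intrM e intrD intrM -pmulrn natrX.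
  by apply: (mulfI b0); rewrite mulrBr e; field.
have cC : (fun k => (c k)%:~R) \in padic_cauchy p.
  apply/asboolP => k; exists k => m n km kn.
  have -> : (c m)%:~R - (c n)%:~R =
    ((c m)%:~R - (b%:~R)^-1) - ((c n)%:~R - (b%:~R)^-1) :> rat by ring.
  by apply: pdvdB; [apply: (pdvdW km)|apply: (pdvdW kn)]; apply: diff.
exists (Sub (fun k => (c k)%:~R) cC : cauchy_seq p) => [n|]; first exact: intr_int.
apply/padic_eqP => k; exists k => n kn /=.
by apply: (pdvdW kn); apply: diff.
Qed.

Lemma padic_ratD q (u : cauchy_seq p) :
  padic_of_rat p q + quotr_pi (@padic_null p) u =
  quotr_pi (@padic_null p) (Sub (fun=> q) (const_cauchy p q) + u).
Proof. by rewrite rmorphD. Qed.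

Lemma padic_ratM q (u : cauchy_seq p) :
  padic_of_rat p q * quotr_pi (@padic_null p) u =
  quotr_pi (@padic_null p) (Sub (fun=> q) (const_cauchy p q) * u).
Proof. by rewrite rmorphM. Qed.

(** Density of the integers in [Z_p]. The integer is a term [v N] beyond which the sequence is
    constant modulo [p ^ k]; [w] collects the quotients of the later differences by [p ^ k]. *)
Lemma padic_int_approx (a : padic p) k : padic_int a -> exists z : int,
  exists2 w, padic_int w & a = z%:~R + w *+ (sval p ^ k).
Proof.
move=> [u uZ <-]; have /asboolP/(_ k) [N uN] := valP u.
have /choice [v vE] : forall n, exists v : int, val u n = v%:~R.
  by move=> n; have /intrP := uZ n.
have /choice [w wE] : forall n, exists c : int,
    v (N + n)%N - v N = c * (sval p ^ k)%:Z.
  move=> n; apply: pdvd_intP; rewrite intrB -!vE; apply: uN => //.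
  exact: leq_addr.
have pk0 : ((sval p)%:R ^+ k : rat) != 0 by rewrite expf_neq0 // prime_rat_neq0.
have wC : (fun n => (w n)%:~R) \in padic_cauchy p.
  (* Dividing by [p ^ k] costs [k] digits, so [u] is used to precision [k + j]. *)
  apply/asboolP => j; have /asboolP/(_ (k + j)%N) [M uM] := valP u.
  exists M => m n Mm Mn.
  have := uM (N + m)%N (N + n)%N; rewrite !vE.
  have -> : (v (N + m)%N)%:~R - (v (N + n)%N)%:~R =
      (sval p)%:R ^+ k * ((w m)%:~R - (w n)%:~R) :> rat.
    have vNE i : (v (N + i)%N)%:~R = (v N)%:~R + (w i)%:~R * (sval p)%:R ^+ k :> rat.
      by rewrite -natrX pmulrn -intrM -intrD -wE addrC subrK.
    rewrite !vNE; ring.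
  case; [lia|lia|] => c [b [pb e]].
  exists c, b; split=> //; apply: (mulfI pk0); rewrite e exprD; ring.
exists (v N), (quotr_pi (@padic_null p) (Sub (fun k => (w k)%:~R) wC : cauchy_seq p)).
  by exists (Sub (fun k => (w k)%:~R) wC : cauchy_seq p) => // n; exact: intr_int.
rewrite -(rmorph_int (padic_of_rat p)) -mulr_natl -(rmorph_nat (padic_of_rat p)).
rewrite padic_ratM padic_ratD; apply/padic_eqP => j.
have /asboolP/(_ j) [M uM] := valP u.
exists (maxn N M) => n; rewrite geq_max => /andP[Nn Mn].
rewrite rmorphD rmorphM /= !fctE.
(* The constructed sequence is [u] shifted by [N], which differs from [u] by a null sequence. *)
have -> : val u n - ((v N)%:~R + (sval p ^ k)%:R * (w n)%:~R) =
  val u n - val u (N + n)%N.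
  rewrite !vE -[v (N + n)%N](subrK (v N)) wE intrD intrM -pmulrn; ring.
apply: uM => //; lia.
Qed.

(** [Q] meets [p ^ k Z_p] in [p ^ k Z_(p)]: a single late term of an integer sequence representing
    [w] is close enough to show this. *)
Lemma padic_of_rat_pdvd q (w : padic p) k :
  padic_int w -> padic_of_rat p q = w *+ (sval p ^ k) -> pdvd p k q.
Proof.
move=> [u uZ <-]; rewrite -mulr_natl -(rmorph_nat (padic_of_rat p)) padic_ratM.
case/padic_eqP/(_ k) => N /(_ N (leqnn N)); rewrite rmorphM /= !fctE.
have /intrP [z ->] := uZ N; rewrite natrX => h.
rewrite -[q](subrK ((sval p)%:R ^+ k * z%:~R)); apply: pdvdD => //.
exact: pdvd_int.
Qed.
End Padic.

(** * Localization at a prime *)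

Section ZSpan.
Variables (A : comPzRingType) (X : set A).

Lemma zspan_gen x : X x -> zspan X x.
Proof.
by move=> Xx; exists 1%N, (fun=> x), (fun=> 1); rewrite big_ord1.
Qed.

Lemma zspan0 : zspan X 0.
Proof. by exists 0%N, (fun=> 0), (fun=> 0); rewrite big_ord0; split=> // -[]. Qed.

Lemma zspanB x y : zspan X x -> zspan X y -> zspan X (x - y).
Proof.
move=> [m [v [c [Xv ->]]]] [n [w [d [Xw ->]]]].
exists (m + n)%N.
exists (fun k => match fintype.split k with inl i => v i | inr j => w j end).
exists (fun k => match fintype.split k with inl i => c i | inr j => - d j end).
split=> [k|]; first by case: fintype.split.
rewrite big_split_ord -sumrN; congr (_ + _); apply: eq_bigr => i _ /=.
  by rewrite (unsplitK (inl i)).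
by rewrite (unsplitK (inr i)) mulrNz.
Qed.

Lemma zspanN x : zspan X x -> zspan X (- x).
Proof. by move=> ?; rewrite -sub0r; apply: zspanB => //; apply: zspan0. Qed.

Lemma zspanD x y : zspan X x -> zspan X y -> zspan X (x + y).
Proof. by move=> ? ?; rewrite -[y]opprK; apply: zspanB => //; apply: zspanN. Qed.

(** This reduces a statement on [localize] or [ext_ideal] to generators, once it is seen to define a
    subgroup. *)
Lemma zspan_ind (P : set A) : P 0 -> (forall x y, P x -> P y -> P (x - y)) ->
  X `<=` P -> zspan X `<=` P.
Proof.
move=> P0 PB XP _ [m [v [c [Xv ->]]]].
have PN x : P x -> P (- x) by move=> Px; rewrite -sub0r; apply: PB.
have PD x y : P x -> P y -> P (x + y).
  by move=> Px Py; rewrite -[y]opprK; apply/PB/PN.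
apply: (big_ind P) => // i _; have /XP Pi := Xv i.
have Pn n : P (v i *+ n) by elim: n => // n IH; rewrite mulrS; apply: PD.
by case: (c i) => n; rewrite ?NegzE ?mulrNz -pmulrn; [|apply: PN]; apply: Pn.
Qed.
End ZSpan.

Section Localization.
Variables (F : fieldExtType rat) (p : rational_prime).
Implicit Types X Y : set F.
Local Notation inj := (@tensor_inj F _ (padic_of_rat p)).

Lemma tensor_ofMn x (a : padic p) n :
  tensor_of (padic_of_rat p) (x *+ n) a =
  tensor_of (padic_of_rat p) x a *+ n :> tensor F _.
Proof.
elim: n => [|n IH]; first by rewrite !mulr0n tensor_of0l.
by rewrite !mulrS tensor_ofDl IH.
Qed.

Lemma tensor_ofMnr x (a : padic p) n :
  tensor_of (padic_of_rat p) x (a *+ n) =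
  tensor_of (padic_of_rat p) x a *+ n :> tensor F _.
Proof.
elim: n => [|n IH]; first by rewrite !mulr0n tensor_of0r.
by rewrite !mulrS tensor_ofDr IH.
Qed.

Lemma tensor_of_rat x q :
  tensor_of (padic_of_rat p) x (padic_of_rat p q) = inj (q *: x).
Proof. by rewrite /tensor_inj tensor_ofZ mulr1. Qed.

Lemma tensor_of_int x (z : int) : tensor_of (padic_of_rat p) x z%:~R = inj (x *~ z).
Proof. by rewrite -(rmorph_int (padic_of_rat p)) tensor_of_rat scaler_int. Qed.

Lemma localize_of X x (a : padic p) : X x -> padic_int a ->
  localize p X (tensor_of (padic_of_rat p) x a).
Proof. by move=> Xx aZ; apply: zspan_gen; exists x => //; exists a. Qed.

Lemma localize_inj X x : X x -> localize p X (inj x).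
Proof.
move=> Xx; apply: localize_of => //; rewrite -(rmorph1 (padic_of_rat p)).
by apply: padic_int_rat; rewrite -[1](mulr1 1); apply: (pdvd_int p 0 1).
Qed.

Lemma localizeS X Y : X `<=` Y -> localize p X `<=` localize p Y.
Proof.
move=> XY; apply: zspan_ind; [exact: zspan0|exact: zspanB|].
by move=> _ [x /XY Yx [a aZ <-]]; apply: localize_of.
Qed.

Lemma localize_mul X x y : (forall x y, X x -> X y -> X (x * y)) ->
  localize p X x -> localize p X y -> localize p X (x * y).
Proof.
move=> XM; apply: zspan_mul => _ _ [u Xu [a aZ <-]] [v Xv [b bZ <-]].
exists (u * v); first exact: XM.
by exists (a * b); [exact: padic_intM|rewrite -tensor_ofM].
Qed.

(** On a pure tensor the scalar in [Z_p] is replaced by an integer close to it, which then moves to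
    the factor in [X]. *)
Lemma localize_approx X k y : X 0 -> (forall x y, X x -> X y -> X (x - y)) ->
  localize p X y -> exists2 x, X x &
  exists2 z, localize p X z & y = inj x + z *+ (sval p ^ k).
Proof.
move=> X0 XB; move: y.
apply: (@zspan_ind _ _ [set y | exists2 x, X x &
  exists2 z, localize p X z & y = inj x + z *+ (sval p ^ k)]).
- by exists 0 => //; exists 0; rewrite ?raddf0 ?mul0rn ?addr0 //; apply: zspan0.
- move=> _ _ [x Xx [z Xz ->]] [x' Xx' [z' Xz' ->]].
  exists (x - x'); first exact: XB.
  exists (z - z'); first exact: zspanB.
  by rewrite raddfB mulrnBl opprD !addrA; congr (_ - _); rewrite addrAC.
move=> _ [x Xx [a aZ <-]]; have [n [w wZ ->]] := padic_int_approx k aZ.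
exists (x *~ n).
  have XN u : X u -> X (- u) by move=> Xu; rewrite -sub0r; apply: XB.
  have Xn m : X (x *+ m).
    by elim: m => // m IH; rewrite mulrS -[_ *+ _]opprK; apply/XB/XN.
  by case: n => m; rewrite ?NegzE ?mulrNz -pmulrn; [|apply: XN]; apply: Xn.
exists (tensor_of (padic_of_rat p) x w); first exact: localize_of.
by rewrite tensor_ofDr tensor_of_int tensor_ofMnr.
Qed.

(* The [Q_p]-linear extension of [phi], in the coordinates of [tensor] *)
Definition tensor_form (phi : F -> rat) (v : local_alg F p) : padic p :=
  \sum_i v 0 i * padic_of_rat p (phi (vbasis {:F})`_i).

Lemma tensor_formB phi v w :
  tensor_form phi (v - w) = tensor_form phi v - tensor_form phi w.
Proof.
by rewrite /tensor_form -sumrB; apply: eq_bigr => i _; rewrite !mxE mulrBl.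
Qed.

Lemma tensor_formMn phi v n :
  tensor_form phi (v *+ n) = tensor_form phi v *+ n.
Proof.
by rewrite /tensor_form -sumrMnl; apply: eq_bigr => i _; rewrite mulmxnE mulrnAl.
Qed.

(** By linearity the reference basis drops out, so [phi] may be a coordinate in a lattice basis of
    an order, and integrality over [Z_p] can be tested with it. *)
Lemma tensor_form_of (phi : {linear F -> rat^o}) x a :
  tensor_form phi (tensor_of (padic_of_rat p) x a) = padic_of_rat p (phi x) * a.
Proof.
rewrite {2}[x]coord_sumE linear_sum rmorph_sum mulr_suml.
apply: eq_bigr => i _; rewrite mxE linearZ /= rmorphM /=; ring.
Qed.
End Localization.

(** * Orders and their ideals *)

Section Order.
Variables (F : fieldExtType rat) (O : orderOf F).

(** These two sets have the form in which they occur in [congruence_ideles]. Ideals are handled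
    inside [F], where division is available. *)
Definition order_carrier : set F := [set x | x \in (O : {pred F})].
Definition ideal_set (J : ideal (order_ring O)) : set F :=
  [set val x | x in [set x | x \in J]].

Lemma ideal_setB J x y : ideal_set J x -> ideal_set J y -> ideal_set J (x - y).
Proof.
move=> [u uJ <-] [v vJ <-]; exists (u - v); last by rewrite rmorphB.
by rewrite /= rpredB.
Qed.

Lemma ideal_set0 J : ideal_set J 0.
Proof. by exists 0; rewrite ?rmorph0 //= rpred0. Qed.

Lemma ideal_setM J a x : order_carrier a -> ideal_set J x -> ideal_set J (a * x).
Proof.
move=> aO [u uJ <-]; exists (Sub a aO * u); last by rewrite rmorphM.
by rewrite /= ideal_mull.
Qed.

Lemma ideal_setMr J x a : order_carrier a -> ideal_set J x -> ideal_set J (x * a).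
Proof. by rewrite mulrC; apply: ideal_setM. Qed.

Lemma ideal_setN J x : ideal_set J x -> ideal_set J (- x).
Proof. by move=> Jx; rewrite -sub0r; apply: ideal_setB => //; apply: ideal_set0. Qed.

Lemma ideal_setD J x y : ideal_set J x -> ideal_set J y -> ideal_set J (x + y).
Proof.
by move=> Jx Jy; rewrite -[y]opprK; apply: ideal_setB => //; apply: ideal_setN.
Qed.

Lemma ideal_setMz J x z : ideal_set J x -> ideal_set J (x *~ z).
Proof.
by move=> Jx; rewrite -mulrzl; apply: ideal_setM => //;
  rewrite /order_carrier /= rpred_int.
Qed.

Lemma ideal_setS J : ideal_set J `<=` order_carrier.
Proof. by move=> _ [u _ <-]; exact: (valP u). Qed.

Lemma ideal_set_full x : order_carrier x -> ideal_set (full_ideal _) x.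
Proof. by move=> xO; exists (Sub x xO). Qed.

Lemma ideal_set_absz J x (d : int) : ideal_set J (x *~ d) -> ideal_set J (x *+ `|d|%N).
Proof.
case: d => n //; rewrite NegzE mulrNz abszN => /ideal_setN.
by rewrite opprK.
Qed.

Lemma ideal_setP J (x : order_ring O) : ideal_set J (val x) <-> x \in J.
Proof. by split=> [[y yJ /val_inj <-]|xJ] //; exists x. Qed.

Lemma lattice_basisP : exists2 b : (\dim {:F}).-tuple F, basis_of {:F} b &
  forall x, order_carrier x <-> forall i, coord b i x \is a Num.int.
Proof.
have [b bB bP] := lattice_basis (s := O); exists b => // x.
split=> [/bP[c ->] i|xZ].
  have -> : \sum_(i < \dim {:F}) b`_i *~ c i =
      \sum_(i < \dim {:F}) ((c i)%:~R : rat) *: b`_i.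
    by apply: eq_bigr => j _; rewrite scaler_int.
  by rewrite coord_sum_free ?(basis_free bB).
have /choice [c cE] : forall i, exists c : int, coord b i x = c%:~R.
  by move=> i; apply/intrP/xZ.
apply/bP; exists c; rewrite [LHS](coord_basis bB) ?memvf //.
by apply: eq_bigr => i _; rewrite cE scaler_int.
Qed.

(** The caller chooses the denominators: [order_local_rat] supplies ones that are prime to [p]. *)
Lemma common_denominator (I : finType) (q : I -> rat) (a e : I -> int) :
  (forall i, e i != 0) ->
  (forall i, q i = (a i)%:~R / (e i)%:~R) -> 
  forall i, exists c : int, q i * (\prod_i e i)%:~R = c%:~R.
Proof.
move=> e0 qE i; exists (a i * \prod_(j | j != i) e j).
rewrite (bigD1 i) //= qE !intrM; field.
by rewrite intr_eq0.
Qed.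

Lemma int_multiple_in_order x : exists2 n : nat, (0 < n)%N & order_carrier (x *+ n).
Proof.
have [b bB bP] := lattice_basisP.
pose d := \prod_i denq (coord b i x).
have d0 : d != 0 by apply/prodf_neq0 => i _; rewrite denq_neq0.
exists `|d|%N; first by rewrite absz_gt0.
have : order_carrier (x *~ d).
  apply/bP => i; rewrite raddfMz /= -mulrzr.
  have [j|j|c ->] := @common_denominator _ (fun i => coord b i x)
    (fun i => numq (coord b i x)) (fun i => denq (coord b i x)) _ _ i.
  - by rewrite denq_neq0.
  - by rewrite divq_num_den.
  exact: intr_int.
move=> dO; apply: (@ideal_setS (full_ideal _)); apply: ideal_set_absz.
exact: ideal_set_full.
Qed.

(** Some positive multiple [n * x^-1] lies in [O], so [n] lies in [J]. That the ideal is nonzero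
    enters the main proof only through such an integer. *)
Lemma ideal_has_int (J : ideal (order_ring O)) : (exists2 x, x \in J & x != 0) ->
  exists2 N, (0 < N)%N & ideal_set J N%:R.
Proof.
move=> [x xJ x0]; have [n n0 nO] := int_multiple_in_order (val x)^-1.
exists n => //; have -> : n%:R = (val x)^-1 *+ n * val x.
  by rewrite mulrnAl mulVf.
by apply: ideal_setM => //; apply/ideal_setP.
Qed.

(** * Completions of an order and of its ideals at a prime *)

Section Local.
Variable p : rational_prime.
Local Notation inj := (@tensor_inj F _ (padic_of_rat p)).
Local Notation Op := (localize p order_carrier).
Local Notation ext J := (ext_ideal p order_carrier (ideal_set J)).

Lemma order_localM x y : Op x -> Op y -> Op (x * y).
Proof. by apply: localize_mul => u v; apply: rpredM. Qed.

Lemma order_local1 : Op 1.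
Proof. rewrite -(rmorph1 inj); apply: localize_inj; exact: rpred1. Qed.

Lemma ext_ideal_gen J j y : ideal_set J j -> Op y -> ext J (inj j * y).
Proof.
by move=> Jj Oy; apply: zspan_gen; exists (inj j); [exists j|exists y].
Qed.

Lemma ext_ideal_inj J j : ideal_set J j -> ext J (inj j).
Proof.
by move=> Jj; rewrite -[inj j]mulr1; apply: ext_ideal_gen => //; apply: order_local1.
Qed.

Lemma ext_idealM J a y : Op a -> ext J y -> ext J (a * y).
Proof.
move=> Oa; move: y; apply: (@zspan_ind _ _ [set y | ext J (a * y)]) => /=.
- by rewrite mulr0; apply: zspan0.
- by move=> x y; rewrite mulrBr; apply: zspanB.
move=> _ [_ [j Jj <-] [y Oy <-]]; rewrite /= mulrCA.
by apply: ext_ideal_gen => //; apply: order_localM.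
Qed.

Lemma ext_idealS J : ext J `<=` Op.
Proof.
apply: zspan_ind; [exact: zspan0|exact: zspanB|].
move=> _ [_ [j Jj <-] [y Oy <-]]; apply: order_localM => //.
exact/localize_inj/(ideal_setS Jj).
Qed.

Lemma ext_ideal_full : Op `<=` ext (full_ideal _).
Proof.
move=> y Oy; rewrite -[y]mul1r -(rmorph1 inj); apply: ext_ideal_gen => //.
exact/ideal_set_full/rpred1.
Qed.

(** On a generator [inj j * y] the factor [y] is approximated. The error lies in [p ^ k O_p], which
    is good enough when [p ^ k] is the [p]-part of an integer in [J]. *)
Lemma ext_ideal_approx J k y : ext J y -> exists2 x, ideal_set J x &
  exists2 z, Op z & y = inj x + z *+ (sval p ^ k).
Proof.
move: y; apply: (@zspan_ind _ _ [set y | exists2 x, ideal_set J x &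
  exists2 z, Op z & y = inj x + z *+ (sval p ^ k)]).
- by exists 0; [exact: ideal_set0|exists 0; [exact: zspan0|rewrite raddf0 mul0rn addr0]].
- move=> _ _ [x Xx [z Xz ->]] [x' Xx' [z' Xz' ->]].
  exists (x - x'); first exact: ideal_setB.
  exists (z - z'); first exact: zspanB.
  by rewrite raddfB mulrnBl opprD !addrA; congr (_ - _); rewrite addrAC.
move=> _ [_ [j Jj <-] [y Oy <-]].
have [||x Ox [z Oz ->]] := localize_approx k _ _ Oy.
- exact: rpred0.
- by move=> u v; apply: rpredB.
exists (j * x); first exact: ideal_setMr.
exists (inj j * z); last by rewrite mulrDr rmorphM mulrnAr.
apply: order_localM => //; exact/localize_inj/(ideal_setS Jj).
Qed.

(** [F] meets [p ^ k O_p] in [p ^ k O_(p)]. The coordinates in a lattice basis extend to forms with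
    values in [Z_p] on [O_p], so those of [x] lie in [p ^ k Z_(p)]; [d] is the product of their
    denominators. *)
Lemma order_local_rat k x y : Op y -> inj x = y *+ (sval p ^ k) ->
  exists2 d : int, ~~ (sval p %| d)%Z &
  exists2 z, order_carrier z & x *~ d = z *+ (sval p ^ k).
Proof.
have [b bB bP] := lattice_basisP; move=> Oy xE.
have formZ i : padic_int (tensor_form (coord b i) y).
  move: y Oy {xE}.
  apply: (@zspan_ind _ _ [set y | padic_int (tensor_form (coord b i) y)]) => /=.
  - by rewrite -[0](subrr 0) tensor_formB subrr; apply: padic_int0.
  - by move=> u v uZ vZ; rewrite tensor_formB; apply: padic_intB.
  move=> _ [u Ou [a aZ <-]]; rewrite /= tensor_form_of /=; apply: padic_intM => //.
  apply: padic_int_rat; have /bP/(_ i)/intrP[z ->] := Ou.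
  by rewrite -[z%:~R]mul1r; apply: (pdvd_int p 0 z).
have dvd i : pdvd p k (coord b i x).
  apply: (padic_of_rat_pdvd (formZ i)).
  by rewrite -tensor_formMn -xE tensor_form_of mulr1.
have /choice [ae aeP] : forall i, exists ae : int * int, ~~ (sval p %| ae.2)%Z /\
    coord b i x = (sval p)%:R ^+ k * (ae.1%:~R / ae.2%:~R).
  by move=> i; have [a [e h]] := dvd i; exists (a, e).
have pk0 : ((sval p)%:R ^+ k : rat) != 0 by rewrite expf_neq0 // prime_rat_neq0.
pose d := \prod_i (ae i).2; exists d.
  rewrite /d; apply: (big_ind (fun d : int => ~~ (sval p %| d)%Z)) => [|u v|i _].
  - exact: pN1.
  - exact: pNM.
  - by have [] := aeP i.
have dE : (sval p ^ k)%:R = ((sval p)%:R ^+ k : rat) by rewrite natrX.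
exists (((sval p)%:R ^+ k : rat)^-1 *: (x *~ d)); last first.
  by rewrite -scaler_nat dE scalerA mulfV // scale1r.
apply/bP => i; rewrite linearZ /= raddfMz /= -mulrzr.
have [|j|c e] := @common_denominator _
  (fun i => ((sval p)%:R ^+ k)^-1 * coord b i x)
  (fun i => (ae i).1) (fun i => (ae i).2) _ _ i.
- move=> j; have [/pN_neq0] := aeP j; by rewrite intr_eq0.
- by have [pe ->] := aeP j; rewrite /= mulKf.
by rewrite mulrA e intr_int.
Qed.

(** Write [N = p ^ k * N'] with [N'] prime to [p]. Modulo [p ^ k O_p], [x] is some [x'] in [J]; then
    [d * (x - x')] lies in [p ^ k O], and multiplication by [N'] moves it into [N O], hence into
    [J]. *)
Lemma ext_ideal_rat J N x : (0 < N)%N -> ideal_set J N%:R -> ext J (inj x) ->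
  exists2 d : int, ~~ (sval p %| d)%Z & ideal_set J (x *~ d).
Proof.
move=> N0 JN; have [N' cp NE] := pfactor_coprime (valP p) N0.
set k := logn _ _ in NE => /(ext_ideal_approx k)[x' Jx' [z Oz xE]].
have [|d pd [y Oy yE]] := @order_local_rat k (x - x') z Oz.
  by rewrite raddfB /= xE addrC addKr.
exists (d * N'%:Z).
  by apply: pNM => //; rewrite dvdzE !absz_nat -prime_coprime // (valP p).
rewrite -[x](subrK x') mulrzDl; apply: ideal_setD; last exact: ideal_setMz.
rewrite mulrzA yE -pmulrn -mulrnA mulnC -NE -mulr_natr.
exact: ideal_setM.
Qed.

(** As [p ^ k / n] is a [p]-adic integer, [p ^ k] times a pure tensor on [x] is [n x] times a scalar
    of [Z_p]. [Y] will be the maximal order, [O], or the set of all [x] with a fixed multiple in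
    [O]. *)
Lemma ext_ideal_scale J (Y : set F) n k y : (0 < n)%N ->
  (forall x, Y x -> ideal_set J (x *+ n)) -> (logn (sval p) n <= k)%N ->
  localize p Y y -> ext J (y *+ (sval p ^ k)).
Proof.
move=> n0 YJ nk; move: y; apply: (@zspan_ind _ _ [set y | ext J (y *+ (sval p ^ k))]) => /=.
- by rewrite mul0rn; apply: zspan0.
- by move=> x y; rewrite mulrnBl; apply: zspanB.
move=> _ [x Yx [a aZ <-]] /=.
have n0' : (n%:R : rat) != 0 by rewrite pnatr_eq0 -lt0n.
have qZ : padic_int (padic_of_rat p ((sval p ^ k)%:R / n%:R)).
  apply: padic_int_rat; have [n' cp nE] := pfactor_coprime (valP p) n0.
  exists (sval p ^ (k - logn (sval p) n))%:Z, n'%:Z; split.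
    by rewrite dvdzE !absz_nat -prime_coprime // (valP p).
  move: n0'; rewrite {1 2}nE expr0 mul1r natrM mulf_eq0 negb_or => /andP[n0' p0].
  rewrite -!pmulrn -{1}(subnK nk) expnD natrM; field.
  by rewrite n0'; rewrite natrX in p0 *.
have -> : tensor_of (padic_of_rat p) x a *+ (sval p ^ k) =
    inj (x *+ n) * tensor_of (padic_of_rat p) 1
      (a * padic_of_rat p ((sval p ^ k)%:R / n%:R)) :> local_alg F p.
  rewrite [RHS]tensor_ofM mulr1 mul1r tensor_ofMn -!tensor_ofMnr.
  congr tensor_of; rewrite -mulrnAr -rmorphMn -mulr_natr divfK //.
  by rewrite rmorph_nat mulr_natr.
apply: ext_ideal_gen; first exact: YJ.
by apply: localize_of; [exact: rpred1|exact: padic_intM].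
Qed.
End Local.

(** Let [n] be the least positive integer with [n x] in [J]. If a prime [p] divides [n], a
    multiplier [d] prime to [p] puts [gcd(n, d) x] in [J] by Bezout; minimality makes [n], hence
    [p], divide [d]. *)
Lemma ideal_local_global J x :
  (forall p : rational_prime,
    exists2 d : int, ~~ (sval p %| d)%Z & ideal_set J (x *~ d)) ->
  ideal_set J x.
Proof.
move=> loc; pose P n := `[< (0 < n)%N /\ ideal_set J (x *+ n) >].
have exP : exists n, P n.
  (* The prime 2 only serves to provide some positive multiplier. *)
  have [d pd dJ] := loc (exist _ 2%N isT); exists `|d|%N.
  apply/asboolP; split; last exact: ideal_set_absz.
  by rewrite absz_gt0; apply: contra pd => /eqP->; rewrite dvdz0.
case: (ex_minnP exP) => n /asboolP[n0 nJ] nmin.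
have [n1|n1] := leqP n 1.
  have n1E : n = 1%N by lia.
  by move: nJ; rewrite n1E mulr1n.
have [d pd dJ] := loc (exist _ (pdiv n) (pdiv_prime n1)).
have [u [v e]] := Bezoutz n d; move: pd => /=.
have gJ : ideal_set J (x *+ `|gcdz n d|%N).
  apply: ideal_set_absz; rewrite -e mulrzDr; apply: ideal_setD.
    by rewrite mulrC mulrzA -pmulrn; apply: ideal_setMz.
  by rewrite mulrC mulrzA; apply: ideal_setMz.
have g0 : (0 < gcdn n `|d|)%N by rewrite gcdn_gt0 n0.
have ng : (n <= gcdn n `|d|)%N by apply: nmin; apply/asboolP.
have nE : gcdn n `|d| = n.
  by apply/eqP; rewrite eqn_leq ng dvdn_leq // dvdn_gcdl.
by rewrite dvdzE /= (dvdn_trans (pdiv_dvd n)) // -nE dvdn_gcdr.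
Qed.

Lemma ideal_ext_global J N x : (0 < N)%N -> ideal_set J N%:R ->
  (forall p, ext_ideal p order_carrier (ideal_set J) (tensor_inj (padic_of_rat p) x)) ->
  ideal_set J x.
Proof.
move=> N0 JN Jx; apply: ideal_local_global => p.
exact: ext_ideal_rat N0 JN (Jx p).
Qed.

Lemma order_local_global x :
  (forall p, localize p order_carrier (tensor_inj (padic_of_rat p) x)) ->
  order_carrier x.
Proof.
move=> Ox; apply: (@ideal_setS (full_ideal _)).
apply: (@ideal_ext_global (full_ideal _) 1%N x) => // [|p].
  exact/ideal_set_full/rpred1.
exact: ext_ideal_full.
Qed.
End Order.

(** * Galois descent *)

Section GaloisDescent.
Variables (L : fieldType) (K : set L).
Local Notation gal := (gal_group K).

HB.instance Definition _ (s : gal) :=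
  GRing.isZmodMorphism.Build L L (gal_fun s) (gal_funB s).
HB.instance Definition _ (s : gal) :=
  GRing.isMonoidMorphism.Build L L (gal_fun s) (gal_funM s).

Lemma map_poly_galM (s t : gal) (f : {poly L}) :
  map_poly (s * t)%g f = map_poly s (map_poly t f).
Proof. by rewrite -map_poly_comp. Qed.

(** [f] packages finitely many elements of [L] as coefficients, so that one [w] agrees with [s] on
    all of them at once. *)
Lemma orbit_conjugate (W : set gal) (s : gal) (f : {poly L}) :
  W 1%g -> (forall u v, W u -> W v -> W (u * v)%g) ->
  finite_set [set map_poly w f | w in W] ->
  (forall x, (forall w, W w -> w x = x) -> s x = x) ->
  exists2 w, W w & map_poly s f = map_poly w f.
Proof.
move=> W1 WM /finite_seqP[orb0 orbE] sfix.
pose orb := undup orb0.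
have orbP g : reflect ([set map_poly w f | w in W] g) (g \in orb).
  by rewrite mem_undup orbE; apply: idP.
pose P := \prod_(g <- orb) ('X - g%:P).
have Pmap (t : gal) : map_poly (map_poly t) P =
    \prod_(g <- map (map_poly t) orb) ('X - g%:P).
  rewrite rmorph_prod big_map; apply: eq_bigr => g _.
  by rewrite rmorphB /= map_polyX map_polyC.
have Pfix w : W w -> map_poly (map_poly w) P = P.
  move=> Ww; rewrite Pmap; apply: perm_big; apply: uniq_perm.
  - rewrite map_inj_uniq ?undup_uniq //.
    by apply: map_inj_poly; [exact: fmorph_inj|exact: rmorph0].
  - exact: undup_uniq.
  (* Acting injectively on the finite orbit and mapping it into itself, [w] permutes it. *)
  - have sub : {subset map (map_poly w) orb <= orb}.
      move=> _ /mapP[g /orbP[v Wv <-] ->]; apply/orbP.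
      exists (w * v)%g; first exact: WM.
      exact: map_poly_galM.
    have [] // := uniq_min_size _ sub.
      rewrite map_inj_uniq ?undup_uniq //.
      by apply: map_inj_poly; [exact: fmorph_inj|exact: rmorph0].
    by rewrite size_map.
have PfixE : map_poly (map_poly s) P = P.
  apply/polyP => i; apply/polyP => j; rewrite !coef_map /=; apply: sfix => w Ww.
  by rewrite -{2}(Pfix w Ww) !coef_map.
have fr : root P f.
  rewrite root_prod_XsubC; apply/orbP; exists 1%g => //.
  by apply/polyP => i; rewrite coef_map.
have : root P (map_poly s f).
  by rewrite -PfixE /root horner_map (eqP fr) rmorph0.
by rewrite root_prod_XsubC => /orbP[w Ww wE]; exists w.
Qed.

Lemma Poly_gal_eq (s t : gal) (xs : seq L) :
  map_poly s (Poly xs) = map_poly t (Poly xs) -> {in xs, s =1 t}.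
Proof.
move=> e x /(nthP 0)[i _ <-].
by have := congr1 (fun f : {poly L} => f`_i) e; rewrite !coef_map /= coef_Poly.
Qed.

Lemma finite_roots (f : {poly L}) : f != 0 -> finite_set [set x | root f x].
Proof.
have [n] := ubnP (size f); elim: n f => // n IH f sf f0.
have [[a ra]|nr] := pselect (exists a, root f a); last first.
  apply: (sub_finite_set _ (finite_set0 L)) => x /= fx.
  by case: nr; exists x.
have [q fE] := factor_theorem f a ra.
have q0 : q != 0 by apply: contra f0 => /eqP q0; rewrite fE q0 mul0r.
have -> : [set x | root f x] = [set x | root q x] `|` [set a].
  apply/seteqP; split=> x /=; rewrite fE rootM root_XsubC.
    by case/orP=> [|/eqP]; [left|right].
  by case=> [->|->] //; rewrite eqxx orbT.
rewrite finite_setU; split; last exact: finite_set1.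
by apply: IH => //; move: sf; rewrite fE size_Mmonic ?monicXsubC // size_XsubC addn2.
Qed.

Lemma finite_orbit (W : set gal) (xs : seq L) :
  (forall x, x \in xs -> finite_set [set w x | w in W]) ->
  finite_set [set map_poly w (Poly xs) | w in W].
Proof.
elim: xs => [|x xs IH] fin.
  apply: (sub_finite_set _ (finite_set1 0)) => _ [w _ <-].
  by rewrite /= rmorph0.
apply: (sub_finite_set (B := [set g * 'X + c%:P | g in
  [set map_poly w (Poly xs) | w in W] & c in [set w x | w in W]])).
  move=> _ [w Ww <-]; exists (map_poly w (Poly xs)); first by exists w.
  exists (w x); first by exists w.
  rewrite (_ : Poly (x :: xs) = cons_poly x (Poly xs)) //.
  by rewrite cons_poly_def rmorphD rmorphM /= map_polyX map_polyC.
apply: finite_image2; last by apply: fin; rewrite mem_head.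
by apply: IH => y yxs; apply: fin; rewrite in_cons yxs orbT.
Qed.

(** Openness at 1 gives a finite list [xs] such that [W] contains every automorphism fixing [xs].
    Orbits are finite by algebraicity, so some [w] in [W] agrees with [s] on [xs], and [w^-1 s]
    fixes [xs]. *)
Lemma open_subgroup_galois (W : set gal) (s : gal) :
  (forall x, exists2 f : {poly L}, f != 0 & (forall i, K f`_i) /\ root f x) ->
  W 1%g -> (forall u v, W u -> W v -> W (u * v)%g) -> krull_open W ->
  (forall x, (forall w, W w -> w x = x) -> s x = x) -> W s.
Proof.
move=> alg W1 WM /(_ _ W1)[xs Wxs] sfix.
have fin : finite_set [set map_poly w (Poly xs) | w in W].
  apply: finite_orbit => x _; have [f f0 [Kf fx]] := alg x.
  apply: sub_finite_set (finite_roots f0) => _ [w _ <-] /=.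
  have <- : map_poly w f = f by apply/polyP => i; rewrite coef_map /= gal_fix.
  by rewrite /root horner_map (eqP fx) rmorph0.
have [w Ww /Poly_gal_eq sw] := orbit_conjugate W1 WM fin sfix.
rewrite -[s](mulVKg w); apply: WM => //; apply: Wxs => x xxs.
by rewrite /= sw // gal_funK.
Qed.

(** If [s] is not in [W], choose for each [w] in [W] a point where [s] and [w] differ. No [w] then
    agrees with [s] on this finite family, against [orbit_conjugate]. *)
Lemma finite_group_galois (W : set gal) (s : gal) : finite_set W ->
  W 1%g -> (forall u v, W u -> W v -> W (u * v)%g) ->
  (forall x, (forall w, W w -> w x = x) -> s x = x) -> W s.
Proof.
move=> Wfin W1 WM sfix; have /finite_seqP[ws WE] := Wfin.
apply: contrapT => Ws.
have /choice [x_ xP] : forall w : gal, exists x, W w -> s x <> w x.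
  move=> w; apply: contrapT => nx; apply: Ws.
  have [Ww|nWw] := pselect (W w); last by case: nx; exists 0.
  suff -> : s = w by [].
  apply: gal_eq => x; apply: contrapT => sx; by case: nx; exists x.
have fin : finite_set [set map_poly w (Poly (map x_ ws)) | w in W].
  exact: finite_image.
have [w Ww /Poly_gal_eq sw] := orbit_conjugate W1 WM fin sfix.
apply: (xP w Ww); apply: sw; apply: map_f.
by move: Ww; rewrite WE.
Qed.
End GaloisDescent.

(** * Integers have bounded denominators over an order *)

Section Integrality.
Variables (F : fieldExtType rat) (O : orderOf F).

(** Multiplication by [x] has an integer matrix in a lattice basis, and [x] is an eigenvalue of
    it. *)
Lemma order_integral : order_carrier O `<=` @integers F.
Proof.
move=> x xO; have [b bB bP] := lattice_basisP O.
have /choice [c cE] : forall ij : 'I_(\dim {:F}) * 'I_(\dim {:F}), exists c : int,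
    coord b ij.2 (x * b`_ij.1) = c%:~R.
  move=> [i j] /=; have /bP/(_ j)/intrP // : order_carrier O (x * b`_i).
  apply: rpredM => //; apply/bP => k.
  by rewrite coord_free ?(basis_free bB) // rpred_nat.
(* The indices are swapped so that the row of basis vectors is an eigenvector for left
   multiplication, with eigenvalue [x]. *)
pose M := \matrix_(i, j) c (j, i).
exists (char_poly M); first exact: char_poly_monic.
rewrite map_char_poly -eigenvalue_root_char; apply/eigenvalueP.
exists (\row_i b`_i).
  apply/rowP => i; rewrite !mxE [RHS](coord_basis bB) ?memvf //.
  by apply: eq_bigr => j _; rewrite !mxE /= mulrzr -scaler_int -cE.
apply/negP => /eqP/rowP b0.
have n0 : (0 < \dim {:F})%N by rewrite adim_gt0.
have := coord_free (Ordinal n0) (Ordinal n0) (basis_free bB).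
by have := b0 (Ordinal n0); rewrite !mxE => ->; rewrite linear0 eqxx => /esym/eqP;
  rewrite oner_eq0.
Qed.

(** * The trace of [F] over [Q] *)

Section Trace.
Variables (b : (\dim {:F}).-tuple F) (bB : basis_of {:F} b).

Definition mul_mx (y : F) : 'M[rat]_(\dim {:F}) := \matrix_(i, j) coord b j (b`_i * y).
Definition ext_trace (y : F) : rat := \tr (mul_mx y).

Lemma mul_mxD x y : mul_mx (x + y) = mul_mx x + mul_mx y.
Proof. by apply/matrixP => i j; rewrite !mxE mulrDr linearD. Qed.

Lemma mul_mxZ a x : mul_mx (a *: x) = a *: mul_mx x.
Proof. by apply/matrixP => i j; rewrite !mxE -scalerAr linearZ. Qed.

Lemma mul_mx1 : mul_mx 1 = 1%:M.
Proof.
by apply/matrixP => i j; rewrite !mxE mulr1 coord_free ?(basis_free bB) // eq_sym.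
Qed.

Lemma mul_mxM x y : mul_mx (x * y) = mul_mx x *m mul_mx y.
Proof.
apply/matrixP => i j; rewrite !mxE mulrA {1}[b`_i * x](coord_basis bB) ?memvf //.
rewrite mulr_suml linear_sum; apply: eq_bigr => k _.
by rewrite !mxE -scalerAl linearZ.
Qed.

(** Over [algC] the trace is the sum of the eigenvalues. Each of them is a root of the monic integer
    polynomial that kills [x], hence an algebraic integer, and a rational algebraic integer is an
    integer. *)
Lemma ext_trace_int x : integers x -> ext_trace x \is a Num.int.
Proof.
move=> [p pm /eqP px].
pose f := @ratr algC.
pose A := map_mx f (mul_mx x).
have powers (q : {poly int}) (v : 'rV_(\dim {:F})) l : v *m A = l *: v ->
    v *m map_mx f (mul_mx (map_poly intr q).[x]) = (map_poly intr q).[l] *: v.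
  move=> vl; elim/poly_ind: q => [|q c IH].
    rewrite !rmorph0 !horner0 scale0r -(scale0r (1 : F)) mul_mxZ scale0r.
    by rewrite map_mx0 mulmx0.
  rewrite !rmorphD !rmorphM /= !map_polyX !map_polyC /= !hornerMXaddC mul_mxD mul_mxM.
  rewrite map_mxD map_mxM mulmxDr mulmxA IH -scalemxAl vl scalerA scalerDl.
  congr (_ + _); rewrite -scaler_int mul_mxZ mul_mx1.
  by rewrite map_mxZ map_mx1 -scalemxAr mulmx1 /= /f rmorph_int.
have [rs rsE] := closed_field_poly_normal (char_poly A).
rewrite (eqP (char_poly_monic A)) scale1r in rsE.
have n0 : (0 < \dim {:F})%N by rewrite adim_gt0.
have srs : size rs = \dim {:F}.
  by apply: succn_inj; rewrite -(size_prod_XsubC rs id) -rsE size_char_poly.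
have trE : \tr A = \sum_(z <- rs) z.
  apply: oppr_inj; rewrite -char_poly_trace // rsE -srs coefPn_prod_XsubC //.
  by rewrite srs -lt0n.
have trAint : f (ext_trace x) \in Aint.
  rewrite /ext_trace /f -trace_map_mx -/A trE big_seq; apply: rpred_sum => l lrs.
  have : root (char_poly A) l by rewrite rsE root_prod_XsubC.
  rewrite -eigenvalue_root_char => /eigenvalueP [v vl v0].
  have := powers p v l vl; rewrite px -(scale0r (1 : F)) mul_mxZ scale0r map_mx0 mulmx0.
  move=> /esym/eqP; rewrite scaler_eq0 (negPf v0) orbF => pl.
  apply: (root_monic_Aint (p := map_poly intr p)) => //.
    exact: monic_map.
  by apply/polyOverP => i; rewrite coef_map /= intr_int.
have : f (ext_trace x) \in Num.int by apply: Cint_rat_Aint => //; apply: Crat_rat.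
by case/intrP => z; rewrite -(ratr_int _ z) => /fmorph_inj ->; exact: intr_int.
Qed.
End Trace.

(** The maximal order lies in the dual of [O] under the trace form: the coordinates of an integral
    [x] come from the integers [T (x * b_i)] through the inverse Gram matrix [H], and [d] clears the
    denominators of [H]. *)
Lemma integers_denominator : exists2 M : nat, (0 < M)%N &
  forall x : F, integers x -> order_carrier O (x *+ M).
Proof.
have [b bB bP] := lattice_basisP O.
pose T := ext_trace b.
pose G := \matrix_(i < \dim {:F}, j < \dim {:F}) T (b`_i * b`_j).
have TD u v : T (u + v) = T u + T v by rewrite /T /ext_trace mul_mxD raddfD.
have TZ a u : T (a *: u) = a * T u by rewrite /T /ext_trace mul_mxZ mxtraceZ.
have T0 : T 0 = 0 by rewrite -(scale0r (1 : F)) TZ mul0r.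
have Tsum (q : 'I_(\dim {:F}) -> rat) (w : 'I_(\dim {:F}) -> F) :
    T (\sum_i q i *: w i) = \sum_i q i * T (w i).
  rewrite (big_morph T TD T0); apply: eq_bigr => i _; exact: TZ.
have GE (q : 'rV_(\dim {:F})) j : (q *m G) 0 j = T ((\sum_i q 0 i *: b`_i) * b`_j).
  rewrite mxE mulr_suml; under [in RHS]eq_bigr do rewrite -scalerAl.
  by rewrite Tsum; apply: eq_bigr => i _; rewrite mxE.
(* The trace form is nondegenerate: a nonzero [y] pairs with [y^-1] to the trace of 1, which is the
   degree of [F]. *)
have Gu : G \in unitmx.
  rewrite -row_free_unit; apply: inj_row_free => q qG.
  pose y := \sum_i q 0 i *: b`_i.
  have Ty z : T (y * z) = 0.
    rewrite [z](coord_basis bB) ?memvf // mulr_sumr.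
    under eq_bigr do rewrite -scalerAr.
    by rewrite Tsum big1 // => j _; rewrite -GE qG mxE mulr0.
  have y0 : y = 0.
    apply/eqP; apply: contraT => y0; have := Ty y^-1; rewrite mulfV //.
    rewrite /T /ext_trace mul_mx1 // mxtrace1 => /eqP.
    by rewrite pnatr_eq0 -leqn0 leqNgt adim_gt0.
  apply/rowP => i; rewrite mxE.
  have := coord_sum_free (q 0) i (basis_free bB).
  by rewrite -/y y0 linear0 => <-.
pose H := invmx G.
pose d := \prod_(ij : 'I_(\dim {:F}) * 'I_(\dim {:F})) denq (H ij.1 ij.2).
have d0 : d != 0 by apply/prodf_neq0 => i _; rewrite denq_neq0.
exists `|d|%N; first by rewrite absz_gt0.
move=> x xZ; apply: (@ideal_setS _ _ (full_ideal _)); apply: ideal_set_absz.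
apply: ideal_set_full; apply/bP => j.
pose q := \row_i coord b i x.
have xE : x = \sum_i q 0 i *: b`_i.
  by rewrite {1}[x](coord_basis bB) ?memvf //; apply: eq_bigr => i _; rewrite mxE.
have -> : coord b j (x *~ d) = \sum_i (q *m G) 0 i * (H i j * d%:~R).
  under eq_bigr do rewrite mulrA.
  rewrite raddfMz /= -mulrzr -mulr_suml; congr (_ * _).
  have qE : q *m G *m H = q by rewrite -mulmxA mulmxV // mulmx1.
  by have := congr1 (fun A : 'rV_ _ => A 0 j) qE; rewrite mxE [RHS]mxE => ->.
apply: rpred_sum => i _; apply: rpredM.
  rewrite GE -xE; apply: ext_trace_int => //; apply: integersM => //.
  apply: order_integral; apply/bP => k.
  by rewrite coord_free ?(basis_free bB) // rpred_nat.
have [ij|ij|c ->] := @common_denominator _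
  (fun ij : 'I_(\dim {:F}) * 'I_(\dim {:F}) => H ij.1 ij.2)
  (fun ij => numq (H ij.1 ij.2)) (fun ij => denq (H ij.1 ij.2)) _ _ (i, j).
- by rewrite denq_neq0.
- by rewrite divq_num_den.
exact: intr_int.
Qed.
End Integrality.

(** * Approximation and lifting of units in an order *)

Section OrderArithmetic.
Variables (F : fieldExtType rat) (O : orderOf F).
Local Notation OO := (order_carrier O).

Definition order_multiple (m : nat) : set F := [set z *+ m | z in OO].

Lemma order_multipleB m x y :
  order_multiple m x -> order_multiple m y -> order_multiple m (x - y).
Proof.
move=> [z zO <-] [w wO <-]; exists (z - w); last by rewrite mulrnBl.
exact: rpredB.
Qed.

Lemma order_multiple0 m : order_multiple m 0.
Proof. by exists 0; rewrite ?mul0rn //; exact: rpred0. Qed.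

Lemma order_multipleM m a x : OO a -> order_multiple m x -> order_multiple m (a * x).
Proof.
by move=> aO [z zO <-]; exists (a * z); [exact: rpredM|rewrite mulrnAr].
Qed.

Lemma order_multipleD m x y :
  order_multiple m x -> order_multiple m y -> order_multiple m (x + y).
Proof.
move=> xm ym; rewrite -[y]opprK -[- y]sub0r; do ![apply: order_multipleB => //].
exact: order_multiple0.
Qed.

Lemma order_multiple_dvdn m n x : OO x -> (m %| n)%N -> order_multiple m (x *+ n).
Proof.
move=> xO /dvdnP[k ->]; exists (x *+ k); last by rewrite mulrnA.
exact: rpredMn.
Qed.

Lemma order_multiple_ideal (J : ideal (order_ring O)) m :
  ideal_set J m%:R -> order_multiple m `<=` ideal_set J.
Proof. by move=> Jm _ [z zO <-]; rewrite -mulr_natr; apply: ideal_setM. Qed.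

(** At a prime not dividing [N] the modulus is [p ^ 0], so only the primes of [N] enter the sum. *)
Lemma order_chinese N (x_ : rational_prime -> F) : (0 < N)%N -> (forall p, OO (x_ p)) ->
  exists2 x, OO x & forall p, order_multiple (sval p ^ logn (sval p) N) (x - x_ p).
Proof.
move=> N0 x_O.
(* [e q] is 1 modulo the [q]-part of [N] and 0 modulo the complementary part. The default 0 in [y]
   is for composite [q], which do not occur in [primes N]. *)
pose e (q : nat) := chinese (N`_q) (N`_(negn q)) 1 0.
pose y (q : nat) := odflt 0 (omap x_ (insub q : option rational_prime)).
have yO q : OO (y q) by rewrite /y; case: insub => [p|] /=; [exact: x_O|exact: rpred0].
have xO : OO (\sum_(q <- primes N) y q *+ e q).
  by rewrite /order_carrier /=; apply: rpred_sum => q _; apply: rpredMn; apply: yO.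
exists (\sum_(q <- primes N) y q *+ e q) => // p.
have yp : y (sval p) = x_ p by rewrite /y valK.
have [pN|pN] := boolP (sval p \in primes N); last first.
  rewrite -logn_gt0 -eqn0Ngt in pN.
  rewrite (eqP pN) expn0; exists (\sum_(q <- primes N) y q *+ e q - x_ p) => //.
  by apply: rpredB => //; apply: x_O.
rewrite (bigD1_seq (sval p)) ?primes_uniq //= yp addrAC; apply: order_multipleD.
  have m1 : (1 < N`_(sval p))%N.
    by rewrite p_part -{1}(expn0 (sval p)) ltn_exp2l ?prime_gt1 ?(valP p) // logn_gt0.
  have -> : e (sval p) = ((e (sval p) %/ N`_(sval p)) * N`_(sval p) + 1)%N.
    rewrite [LHS](divn_eq _ (N`_(sval p))).
    by rewrite /e chinese_modl ?coprime_partC // modn_small.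
  rewrite mulrnDr addrK -p_part; apply: order_multiple_dvdn; first exact: x_O.
  exact: dvdn_mull.
rewrite big_seq_cond.
apply: (big_ind (order_multiple (sval p ^ logn (sval p) N))) => [|u v|q /andP[qN qp]].
- exact: order_multiple0.
- exact: order_multipleD.
apply: order_multiple_dvdn => //.
have := chinese_modr (coprime_partC q N N) 1 0; rewrite -/(e q) mod0n => /eqP.
apply: dvdn_trans; rewrite -p_part.
have q_pr : prime q by move: qN; rewrite mem_primes => /andP[].
rewrite -(@Gauss_dvdr _ N`_q) ?partnC // ?dvdn_part //.
rewrite !p_part coprimeXl // coprimeXr // prime_coprime ?(valP p) //.
by rewrite dvdn_prime2 ?(valP p) // eq_sym.
Qed.

(** Coordinates modulo [N] take finitely many values, so two powers of [x] agree modulo [N], and the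
    powers are periodic with period [d] from exponent [i] on. *)
Lemma order_power_idempotent N x : (0 < N)%N -> OO x ->
  exists2 m, (0 < m)%N & order_multiple N (x ^+ m * x ^+ m - x ^+ m).
Proof.
move=> N0 xO; have [b bB bP] := lattice_basisP O.
have /choice [c cE] : forall ki : nat * 'I_(\dim {:F}), exists z : int,
    coord b ki.2 (x ^+ ki.1) = z%:~R.
  by move=> [k i] /=; apply/intrP; move: i; apply/bP; apply: rpredX.
have NZ : (N%:Z != 0) by rewrite -lt0n.
have rN ki : (`|(c ki %% N%:Z)%Z|%N < N)%N.
  rewrite -ltz_nat gez0_abs ?modz_ge0 //; exact: ltz_pmod.
pose r k := [ffun i => Ordinal (rN (k, i))].
pose M := #|{ffun 'I_(\dim {:F}) -> 'I_N}|.
have /injectivePn [i [j ij rij]] : ~~ injectiveb (fun k : 'I_M.+1 => r k).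
  apply/negP => /injectiveP/leq_card; by rewrite card_ord ltnn.
wlog ltij : i j ij rij / (i < j)%N.
  move=> wl; have : (i != j :> nat) by [].
  by rewrite neq_ltn => /orP[]; apply: wl; rewrite // eq_sym.
pose d := (j - i)%N.
have step : order_multiple N (x ^+ (i + d) - x ^+ i).
  rewrite subnKC ?(ltnW ltij) //.
  have /choice [q qE] : forall l, exists q : int,
      c (j : nat, l) - c (i : nat, l) = q * N%:Z.
    move=> l; have /ffunP/(_ l) := rij; rewrite !ffunE => /(congr1 val) /= e.
    apply/dvdzP; rewrite -eqz_mod_dvd; apply/eqP.
    by rewrite -[LHS]gez0_abs ?modz_ge0 // -e gez0_abs ?modz_ge0.
  exists ((N%:R : rat)^-1 *: (x ^+ j - x ^+ i)); last first.
    by rewrite -scaler_nat scalerA mulfV ?scale1r // pnatr_eq0 -lt0n.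
  apply/bP => l; rewrite linearZ linearB /=.
  rewrite (cE (j : nat, l)) (cE (i : nat, l)) -intrB qE.
  by rewrite /GRing.scale /= intrM mulrC mulfK ?intr_int // pnatr_eq0 -lt0n.
have steps k l : order_multiple N (x ^+ (i + l + k * d) - x ^+ (i + l)).
  elim: k => [|k IH]; first by rewrite addn0 subrr; apply: order_multiple0.
  have -> : x ^+ (i + l + k.+1 * d) - x ^+ (i + l) =
      x ^+ (l + k * d) * (x ^+ (i + d) - x ^+ i) + (x ^+ (i + l + k * d) - x ^+ (i + l)).
    rewrite mulrBr -!exprD addrA; congr (_ - _).
    have -> : (l + k * d + (i + d) = i + l + k.+1 * d)%N by lia.
    have -> : (l + k * d + i = i + l + k * d)%N by lia.
    by rewrite subrK.
  by apply: order_multipleD => //; apply: order_multipleM => //; apply: rpredX.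
(* This exponent is a positive multiple of the period and at least [i], so doubling it does not
   change the power modulo [N]. *)
exists (i.+1 * d)%N; first by rewrite muln_gt0 /d subn_gt0 ltij.
have := steps i.+1 (i.+1 * d - i)%N; rewrite subnKC ?exprD //.
by rewrite /d; nia.
Qed.

(* With [e] an idempotent power of [x] modulo [N], the element [x e + (1 - e)]
   is a unit modulo [N], and [e] is [1] modulo [J] since [x] is a unit there. *)
Lemma order_unit_lift (J : ideal (order_ring O)) N x x' :
  (0 < N)%N -> ideal_set J N%:R -> OO x -> OO x' -> ideal_set J (x * x' - 1) ->
  exists y y', [/\ OO y, OO y', ideal_set J (y - x) & order_multiple N (y * y' - 1)].
Proof.
move=> N0 JN xO x'O xx'; have [[//|m] _ idem] := order_power_idempotent N0 xO.
set e := x ^+ m.+1 in idem.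
have eO : OO e by apply: rpredX.
have O1 : OO 1 by apply: rpred1.
have fO : OO (1 - e) by apply: rpredB.
have xmO : OO (x ^+ m) by apply: rpredX.
have J1e : ideal_set J (1 - e).
  have -> : 1 - e = (1 - e) * (1 - (x * x') ^+ m.+1) - x' ^+ m.+1 * (e * e - e).
    by rewrite exprMn -/e; ring.
  apply: ideal_setB; last first.
    apply: ideal_setM; first exact: rpredX.
    exact: order_multiple_ideal JN _ idem.
  apply: ideal_setM => //; rewrite -opprB subrX1 -mulNr.
  apply: ideal_setMr; last exact: ideal_setN.
  by rewrite /order_carrier /=; apply: rpred_sum => i _; apply: rpredX; apply: rpredM.
(* The second witness inverts the first modulo [N], because [x * x ^+ m] is [e]. *)
exists (x * e + (1 - e)), (x ^+ m * e + (1 - e)); split.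
- by apply: rpredD => //; apply: rpredM.
- by apply: rpredD => //; apply: rpredM.
- have -> : x * e + (1 - e) - x = (1 - x) * (1 - e) by ring.
  by apply: ideal_setM => //; apply: rpredB.
have -> : (x * e + (1 - e)) * (x ^+ m * e + (1 - e)) - 1 =
    (e + 1 + 1 - x - x ^+ m) * (e * e - e).
  have -> : e = x * x ^+ m by rewrite /e exprS.
  ring.
apply: order_multipleM => //; do 2![apply: rpredB => //].
by do 2![apply: rpredD => //].
Qed.

(** Let [D = D' * p ^ j] be a denominator of [y^-1], with [D'] prime to [p]. As [y y' = 1 - t] with
    [t] in [p O], a geometric series cut at [t ^ j] gives [W] with [y W = 1 - t ^ j], and [t ^ j]
    absorbs the factor [p ^ j] of [D]. *)
Lemma order_unit_mod_prime (p : rational_prime) y y' : OO y -> OO y' ->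
  order_multiple (sval p) (y * y' - 1) ->
  y != 0 /\ exists2 d : int, ~~ (sval p %| d)%Z & OO (y^-1 *~ d).
Proof.
move=> yO y'O [z zO zE]; have [b bB bP] := lattice_basisP O.
have y0 : y != 0.
  (* If [y] were 0, then [p z = -1]; a coordinate of [p z b_i] would make [p] divide 1. *)
  apply/negP => /eqP y0; move: zE; rewrite y0 mul0r sub0r => zE.
  have n0 : (0 < \dim {:F})%N by rewrite adim_gt0.
  have [i] : exists i : 'I_(\dim {:F}), i == i by exists (Ordinal n0).
  move=> _; have biO : OO b`_i.
    by apply/bP => k; rewrite coord_free ?(basis_free bB) // rpred_nat.
  have /bP/(_ i)/intrP[c cE] : OO (z * b`_i) by apply: rpredM.
  have : coord b i (z * b`_i *+ sval p) = -1.
    by rewrite -mulrnAl zE mulN1r linearN /= coord_free ?(basis_free bB) // eqxx.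
  rewrite raddfMn /= cE -mulr_natr => e.
  have {}e : c * (sval p)%:Z = - 1.
    by apply: (@intr_inj rat); rewrite intrM -pmulrn e.
  have /negP := pN1 p; apply; apply/dvdzP; exists (- c).
  by rewrite mulNr e opprK.
split=> //.
have [D D0 DO] := int_multiple_in_order O y^-1.
have [D' cD DE] := pfactor_coprime (valP p) D0; set j := logn _ _ in DE.
exists D'%:Z; first by rewrite dvdzE !absz_nat -prime_coprime // (valP p).
pose t := - (z *+ sval p).
pose W := y' * \sum_(i < j) t ^+ i.
have tO : OO t by rewrite /order_carrier /= rpredN; apply: rpredMn.
have WO : OO W.
  rewrite /order_carrier /=; apply: rpredM => //.
  by apply: rpred_sum => i _; apply: rpredX.
have yW : y * W = 1 - (- z) ^+ j *+ (sval p ^ j).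
  have yy' : y * y' = 1 - t by rewrite /t opprK zE addrC subrK.
  rewrite mulrA yy' -[1 - t]opprB mulNr -subrX1 opprB /t -mulNrn exprMn_n //.
rewrite -pmulrn.
have WE : y^-1 * D'%:R = W * D'%:R + y^-1 * D%:R * (- z) ^+ j.
  have p0 : (sval p ^ j)%:R != 0 :> F.
    by rewrite -(scaler_nat (R := rat)) scaler_eq0 oner_eq0 orbF pnatr_eq0 -lt0n
      expn_gt0 p_gt0.
  have DF : D%:R = D'%:R * (sval p ^ j)%:R :> F by rewrite -natrM -DE.
  have {}yW : y * W = 1 - (- z) ^+ j * (sval p ^ j)%:R by rewrite yW mulr_natr.
  rewrite DF; clearbody W.
  move: {DF} p0 yW; move: (sval p ^ j)%:R => P p0 yW; move: D'%:R => E.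
  apply: (mulfI y0); apply: (mulIf p0).
  have -> : y * (W * E + y^-1 * (E * P) * (- z) ^+ j) * P =
    y * W * E * P + (y / y) * (E * P) * (- z) ^+ j * P by ring.
  by rewrite yW !mulrA mulfV // mul1r; ring.
rewrite -[y^-1 *+ D']mulr_natr WE !mulr_natr.
apply: rpredD; first exact: rpredMn.
by apply: rpredM => //; apply: rpredX; rewrite rpredN.
Qed.

Lemma order_local_of_multiple (p : rational_prime) x (d : int) :
  ~~ (sval p %| d)%Z -> OO (x *~ d) -> localize p OO (tensor_inj (padic_of_rat p) x).
Proof.
move=> pd dxO; apply: (@ext_idealS _ _ _ (full_ideal _)).
rewrite -[tensor_inj _ _]mulr1n.
apply: (@ext_ideal_scale _ _ _ _ [set x | OO (x *+ `|d|%N)] `|d|%N 0%N) => //.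
- by rewrite absz_gt0; apply: contra pd => /eqP ->; rewrite dvdz0.
- by move=> u; apply: ideal_set_full.
- rewrite leqNgt logn_gt0 mem_primes negb_and; apply/orP; right.
  by rewrite negb_and; apply/orP; right; move: pd; rewrite dvdzE absz_nat.
apply: localize_inj => /=; apply: (@ideal_setS _ _ (full_ideal _)).
exact/ideal_set_absz/ideal_set_full.
Qed.

(** Each [u p] is approximated in [O] modulo the [p]-part of [N], which suffices modulo [J O_p]; the
    Chinese remainder theorem merges the approximations. *)
Lemma local_residue (J : ideal (order_ring O)) N (u : forall p, local_alg F p) :
  (0 < N)%N -> ideal_set J N%:R -> (forall p, localize p OO (u p)) ->
  exists2 x, OO x &
    forall p, ext_ideal p OO (ideal_set J) (u p - tensor_inj (padic_of_rat p) x).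
Proof.
move=> N0 JN uO.
have /choice [x_ xP] : forall p, exists x, OO x /\ exists2 z, localize p OO z &
    u p = tensor_inj (padic_of_rat p) x + z *+ (sval p ^ logn (sval p) N).
  move=> p; have [||x xO [z zO zE]] := localize_approx (logn (sval p) N) _ _ (uO p).
  - exact: rpred0.
  - by move=> ? ?; apply: rpredB.
  by exists x; split=> //; exists z.
have [|x xO xE] := order_chinese N0 (x_ := x_); first by move=> p; have [] := xP p.
exists x => // p; have [xpO [z zO ->]] := xP p; have [w wO wE] := xE p.
have -> : tensor_inj (padic_of_rat p) (x_ p) + z *+ (sval p ^ logn (sval p) N) -
    tensor_inj (padic_of_rat p) x =
    (z - tensor_inj (padic_of_rat p) w) *+ (sval p ^ logn (sval p) N)
    :> local_alg F p.
  have -> : x = x_ p + w *+ (sval p ^ logn (sval p) N) by rewrite wE addrC subrK.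
  by rewrite raddfD raddfMn mulrnBl opprD addrACA subrr add0r.
apply: (ext_ideal_scale (n := N) (Y := OO)) => //.
  by move=> v vO; rewrite -mulr_natr; apply: ideal_setM.
by apply: zspanB => //; apply: localize_inj.
Qed.
End OrderArithmetic.

(** * Congruence ideles *)

Section RingIdentities.
Variable A : comPzRingType.
Implicit Types s t x y : A.

Lemma mul_sub_mul s t x y : s * t - x * y = s * (t - y) + y * (s - x).
Proof. ring. Qed.

Lemma subr_telescope s t x y : t - y - (s - x) + (y - x) = t - s.
Proof. ring. Qed.

Lemma subr_sub2 s x y : s - y - (s - x) = x - y.
Proof. ring. Qed.
End RingIdentities.

Section CongruenceIdeles.
Variables (F : fieldExtType rat) (R : realType) (O : orderOf F).
Local Notation OO := (order_carrier O).
Local Notation inj p := (@tensor_inj F _ (padic_of_rat p)).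
Local Notation ext p J := (ext_ideal p OO (ideal_set J)).
Local Notation U := (@congruence_ideles F R O).
Local Notation Ufull := (U (full_ideal (order_ring O))).
Implicit Types J : ideal (order_ring O).

Lemma tensor_injB p x y : inj p (x - y) = inj p x - inj p y.
Proof. exact: raddfB. Qed.

Lemma tensor_injM p x y : inj p (x * y) = inj p x * inj p y.
Proof. exact: rmorphM. Qed.

Lemma order_valM (x y : order_ring O) : val (x * y) = val x * val y.
Proof. exact: rmorphM. Qed.

Lemma order_valB (x y : order_ring O) : val (x - y) = val x - val y.
Proof. exact: rmorphB. Qed.

Lemma order_valP (x : order_ring O) : OO (val x).
Proof. exact: (valP x). Qed.

Lemma congruence_ideles1 J : U J 1%g.
Proof.
move=> p; split; first by split; exact: order_local1.
by rewrite /= subrr; apply: zspan0.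
Qed.

Lemma congruence_idelesM J s t : U J s -> U J t -> U J (s * t)%g.
Proof.
move=> sJ tJ p; have [[sO sVO] s1] := sJ p; have [[tO tVO] t1] := tJ p.
split; first by split; apply: order_localM.
have -> : uval (idele_at (s * t)%g p) - 1 =
    uval (idele_at s p) * (uval (idele_at t p) - 1) + (uval (idele_at s p) - 1).
  have := mul_sub_mul (uval (idele_at s p)) (uval (idele_at t p)) 1 1.
  by rewrite mulr1 mul1r.
by apply: zspanD => //; apply: ext_idealM.
Qed.

Lemma congruence_idelesV J s : U J s -> U J s^-1%g.
Proof.
move=> sJ p; have [[sO sVO] s1] := sJ p; split; first by [].
have -> : uval (idele_at s^-1%g p) - 1 =
    - (uinv (idele_at s p) * (uval (idele_at s p) - 1)).
  by rewrite mulrBr mulr1 (mulrC (uinv _)) uvalV opprB.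
by apply: zspanN; apply: ext_idealM.
Qed.

Lemma congruence_ideles_full J : U J `<=` Ufull.
Proof.
move=> s sJ p; have [sO s1] := sJ p; split=> //.
by apply: ext_ideal_full; apply: ext_idealS s1.
Qed.

Lemma congruence_ideles_fullP (s : idele F R) :
  (forall p, unit_in (localize p OO) (idele_at s p)) -> Ufull s.
Proof.
move=> sO p; split; first exact: sO.
apply: ext_ideal_full; apply: zspanB; first by have [] := sO p.
exact: order_local1.
Qed.

(** The idele topology refers to the maximal order, so [K = M * N] is chosen to carry the maximal
    order into [J]. At primes dividing [K] closeness to 1 suffices; at the others the completed
    maximal order already lies in [J O_p]. *)
Lemma congruence_ideles_box J N : (0 < N)%N -> ideal_set J N%:R ->
  exists ps k, idele_box ps k setT `<=` U J.
Proof.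
move=> N0 JN; have [M M0 MO] := integers_denominator O.
pose K := (M * N)%N; have K0 : (0 < K)%N by rewrite muln_gt0 M0.
have KJ x : integers x -> ideal_set J (x *+ K).
  by move=> /MO xO; rewrite mulrnA -mulr_natr; apply: ideal_setM.
(* The exponent [K] is a crude bound for all the valuations of [K]. *)
exists (pmap insub (primes K)), K => t [_ tO tK] p.
have [tpO tpVO] := tO p.
have [k kK [y yO yE]] : exists2 k, (logn (sval p) K <= k)%N &
    exists2 y, localize p (@integers F) y & uval (idele_at t p) - 1 = y *+ (sval p ^ k).
  have [pK|pK] := boolP (sval p \in primes K).
    have [|y yO yE] := tK p; first by rewrite mem_pmap_sub.
    by exists K; [exact/ltnW/ltn_logl|exists y].
  exists 0%N; first by rewrite leqNgt logn_gt0.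
  exists (uval (idele_at t p) - 1); last by rewrite expn0.
  by apply: zspanB => //; apply: localize1.
have t1 : ext p J (uval (idele_at t p) - 1).
  by rewrite yE; apply: ext_ideal_scale K0 KJ kK yO.
have tV1 : ext p J (uinv (idele_at t p) - 1).
  have -> : uinv (idele_at t p) - 1 = - (uinv (idele_at t p) * y) *+ (sval p ^ k).
    by rewrite mulNrn -mulrnAr -yE mulrBr mulr1 (mulrC (uinv _)) uvalV opprB.
  have h : localize p (@integers F) (- (uinv (idele_at t p) * y)).
    by apply: zspanN; apply: localizeM.
  exact: ext_ideal_scale K0 KJ kK h.
split=> //; split.
  rewrite -[uval _](subrK 1); apply: zspanD; last exact: order_local1.
  exact: ext_idealS t1.
rewrite -[uinv _](subrK 1); apply: zspanD; last exact: order_local1.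
exact: ext_idealS tV1.
Qed.

Lemma congruence_coset_open J N (s : idele F R) : (0 < N)%N -> ideal_set J N%:R ->
  open [set t | U J (s * t)%g].
Proof.
move=> N0 JN; have [ps [k psU]] := congruence_ideles_box N0 JN.
move=> t st; exists ps, k, setT; split; first exact: filterT.
by move=> r /psU rJ; rewrite /= mulgA; apply: congruence_idelesM.
Qed.

(** The reduction from [U_O] to the units of [O/J], as a relation: one global [x] represents all the
    local residues. Existence and uniqueness follow below. *)
Definition idele_residue J (s : idele F R) (a : units (quotr J)) : Prop :=
  exists2 x : order_ring O, quotr_pi J x = uval a &
    forall p, ext p J (uval (idele_at s p) - inj p (val x)).

Lemma idele_residueM J s t a b : Ufull s ->
  idele_residue s a -> idele_residue (J := J) t b -> idele_residue (s * t)%g (a * b)%g.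
Proof.
move=> sO [x xa xs] [y yb yt]; exists (x * y); first by rewrite rmorphM /= xa yb.
move=> p; have -> : uval (idele_at (s * t)%g p) - inj p (val (x * y)) =
    uval (idele_at s p) * (uval (idele_at t p) - inj p (val y)) +
    inj p (val y) * (uval (idele_at s p) - inj p (val x)).
  by rewrite order_valM tensor_injM; exact: mul_sub_mul.
have [[sp _] _] := sO p.
have yp : localize p OO (inj p (val y)) by apply/localize_inj/order_valP.
exact: zspanD (ext_idealM sp (yt p)) (ext_idealM yp (xs p)).
Qed.

Lemma idele_residue_eq J s t a : Ufull s -> Ufull t ->
  idele_residue s a -> idele_residue (J := J) t a -> U J (s^-1 * t)%g.
Proof.
move=> sO tO [x xa xs] [y ya yt] p.
have [[sp sVp] _] := sO p; have [[tp tVp] _] := tO p; split.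
  by split; apply: order_localM.
have -> : uval (idele_at (s^-1 * t)%g p) - 1 = uinv (idele_at s p) *
    ((uval (idele_at t p) - inj p (val y)) - (uval (idele_at s p) - inj p (val x)) +
     inj p (val y - val x)).
  by rewrite tensor_injB subr_telescope mulrBr
    (mulrC (uinv _) (uval (idele_at s p))) uvalV.
apply: ext_idealM => //; apply: zspanD; first exact: zspanB (yt p) (xs p).
apply: ext_ideal_inj; rewrite -order_valB; apply/ideal_setP.
by apply/quotr_eqP; rewrite xa.
Qed.

Lemma idele_residue_unique J N s a b : (0 < N)%N -> ideal_set J N%:R ->
  idele_residue s a -> idele_residue (J := J) s b -> a = b.
Proof.
move=> N0 JN [x xa xs] [y yb ys]; apply: uval_inj; rewrite -xa -yb.
apply/quotr_eqP/ideal_setP; apply: (ideal_ext_global N0 JN) => p.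
have -> : inj p (val (x - y)) = (uval (idele_at s p) - inj p (val y)) -
   (uval (idele_at s p) - inj p (val x)) by rewrite subr_sub2 order_valB tensor_injB.
exact: zspanB (ys p) (xs p).
Qed.

(** The components of [s] and of its inverse have residues [x] and [y]; [x y - 1] lies in [J O_p]
    for all [p], hence in [J], so the residue is a unit. *)
Lemma idele_residue_exists J N s : (0 < N)%N -> ideal_set J N%:R ->
  Ufull s -> exists a, idele_residue (J := J) s a.
Proof.
move=> N0 JN sO.
have [|x xO xs] := @local_residue _ _ _ _ (fun p => uval (idele_at s p)) N0 JN.
  by move=> p; have [[]] := sO p.
have [|y yO ys] := @local_residue _ _ _ _ (fun p => uinv (idele_at s p)) N0 JN.
  by move=> p; have [[]] := sO p.
pose x' : order_ring O := Sub x xO; pose y' : order_ring O := Sub y yO.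
have xy1 : quotr_pi J x' * quotr_pi J y' = 1.
  rewrite -rmorphM -(rmorph1 (quotr_pi J)); apply/quotr_eqP/ideal_setP.
  apply: (ideal_ext_global N0 JN) => p.
  have -> : inj p (val (x' * y' - 1)) =
      - (uinv (idele_at s p) * (uval (idele_at s p) - inj p x) +
         inj p x * (uinv (idele_at s p) - inj p y)).
    rewrite -mul_sub_mul (mulrC (uinv _)) uvalV opprB (mulrC (inj p y)).
    by rewrite order_valB order_valM tensor_injB tensor_injM.
  have [[_ sVp] _] := sO p.
  have xp : localize p OO (inj p x) by apply: localize_inj.
  exact: zspanN (zspanD (ext_idealM sVp (xs p)) (ext_idealM xp (ys p))).
exists (Units xy1); exists x'; [reflexivity|exact: xs].
Qed.

Lemma order_unit_integral p (u : units (local_alg F p)) :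
  unit_in (localize p OO) u -> unit_in (localize p (@integers F)) u.
Proof. by case=> uO uVO; split; apply: localizeS (@order_integral _ O) _ _. Qed.

Lemma idele_of_local (z : units (arch_alg F R)) (u : forall p, units (local_alg F p)) :
  (forall p, unit_in (localize p OO) (u p)) ->
  exists2 s : idele F R, arch_part s = z & forall p, idele_at s p = u p.
Proof.
move=> uO.
have fin : finite_set [set p | ~ unit_in (localize p (@integers F)) (u p)].
  apply: (sub_finite_set _ (@finite_set0 rational_prime)) => p /=.
  by apply; apply: order_unit_integral.
by exists (Idele z fin).
Qed.

(** The residue is lifted to [y] in [O] invertible modulo [N], and the idele is [y] at the primes
    dividing [N] and 1 elsewhere, where [J O_p] is all of [O_p]. *)
Lemma idele_residue_surj J N (a : units (quotr J)) : (0 < N)%N -> ideal_set J N%:R ->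
  exists2 s, Ufull s & idele_residue s a.
Proof.
move=> N0 JN.
have [x xa] : exists x, quotr_pi J x = uval a by elim/quotrW: (uval a) => x; exists x.
have [x' xa'] : exists x, quotr_pi J x = uinv a by elim/quotrW: (uinv a) => ?; eexists.
have xx' : ideal_set J (val (x * x' - 1)).
  by apply/ideal_setP/quotr_eqP; rewrite rmorphM /= xa xa' uvalV rmorph1.
rewrite order_valB order_valM in xx'.
have [y [y' [yO y'O yx yy']]] :=
  order_unit_lift N0 JN (order_valP x) (order_valP x') xx'.
have loc p : exists u : units (local_alg F p),
    unit_in (localize p OO) u /\ ext p J (uval u - inj p y).
  have [pN|pN] := boolP (sval p %| N)%N; last first.
    exists 1%g; split; first by split; exact: order_local1.
    rewrite -[_ - _]mulr1n -(expn0 (sval p)).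
    apply: (ext_ideal_scale (n := N) (Y := OO)) => //.
    - by move=> v vO; rewrite -mulr_natr; apply: ideal_setM.
    - by rewrite leqNgt logn_gt0 mem_primes (negPf pN) !andbF.
    by apply: zspanB; [exact: order_local1|exact: localize_inj].
  have [|y0 [d pd dO]] := @order_unit_mod_prime _ _ p y y' yO y'O.
    by have [z zO <-] := yy'; apply: order_multiple_dvdn.
  exists (units_map (inj p) (Units (mulfV y0))); split; last first.
    by rewrite /= subrr; apply: zspan0.
  by split; [exact: localize_inj|exact: order_local_of_multiple pd dO].
pose u p := projT1 (cid (loc p)).
have uP p : unit_in (localize p OO) (u p) /\ ext p J (uval (u p) - inj p y).
  exact: projT2 (cid (loc p)).
have [|s _ sE] := @idele_of_local 1%g u; first by move=> p; have [] := uP p.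
exists s.
  by apply: congruence_ideles_fullP => p; rewrite sE; have [] := uP p.
exists x => // p; rewrite sE; have [_ up] := uP p.
have -> : uval (u p) - inj p (val x) = (uval (u p) - inj p y) + inj p (y - val x).
  by rewrite tensor_injB addrA subrK.
by apply: zspanD => //; apply: ext_ideal_inj.
Qed.

Lemma order_unit_idele (x : units (order_ring O)) : exists s : idele F R,
  [/\ principal_idele s, Ufull s &
     forall J, idele_residue s (units_map (quotr_pi J) x)].
Proof.
pose y := units_map (val : order_ring O -> F) x.
have [|s sa sp] := @idele_of_local (units_map (tensor_inj (@ratr R)) y)
    (fun p => units_map (inj p) y).
  by move=> p; split; apply: localize_inj; apply: order_valP.
exists s; split; first by exists y.
  apply: congruence_ideles_fullP => p; rewrite sp.
  by split; apply: localize_inj; apply: order_valP.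
move=> J; exists (uval x) => // p; rewrite sp /= subrr; exact: zspan0.
Qed.

(** The finite components of [r] are 1, so [t] is a unit of [O_p] at every [p]. Its generator [x]
    and the inverse therefore lie in [O], and [x] is congruent to [s] modulo every [J O_p]. *)
Lemma principal_residue J (s t : idele F R) : Ufull s -> principal_idele t ->
  forall r, arch_component r -> U J (s^-1 * (t * r))%g ->
  exists x, idele_residue s (units_map (quotr_pi J) x).
Proof.
move=> sO [x [_ tx]] r [_ r1]; set g := (s^-1 * _)%g => gJ.
have gO := congruence_ideles_full gJ.
have sg : (s * g)%g = (t * r)%g by rewrite /g mulVKg.
have xO p : unit_in (localize p OO) (units_map (inj p) x).
  have [h _] := congruence_idelesM sO gO p.
  by move: h; rewrite sg /= tx r1 mulg1.
have xO1 : OO (uval x) by apply: order_local_global => p; exact: (proj1 (xO p)).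
have xO2 : OO (uinv x) by apply: order_local_global => p; exact: (proj2 (xO p)).
have xV : (Sub (uval x) xO1 : order_ring O) * Sub (uinv x) xO2 = 1.
  by apply: val_inj; rewrite rmorphM /= uvalV.
exists (Units xV); exists (Sub (uval x) xO1); first reflexivity.
move=> p; have [[sp _] _] := sO p; have [_ g1] := gJ p.
have e : uval (idele_at s p) * uval (idele_at g p) = inj p (uval x).
  have -> : uval (idele_at s p) * uval (idele_at g p) = uval (idele_at (s * g)%g p).
    reflexivity.
  rewrite sg; have -> : idele_at (t * r)%g p = (idele_at t p * idele_at r p)%g.
    reflexivity.
  by rewrite tx r1 mulg1.
have eB : uval (idele_at s p) - inj p (uval x) =
    - (uval (idele_at s p) * (uval (idele_at g p) - 1)).
  by rewrite mulrBr mulr1 e opprB.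
change (ext p J (uval (idele_at s p) - inj p (uval x))).
rewrite eB; exact: zspanN (ext_idealM sp g1).
Qed.
End CongruenceIdeles.

(** * Reciprocity *)

(** Two surjections with the same fibres have isomorphic targets. The maps are total but
    multiplicative only on [D], as they will be extended arbitrarily outside it. *)
Lemma isomorphic_common_source (A G H : groupType) (D : set A)
    (phi : A -> G) (psi : A -> H) :
  (forall u v, D u -> D v -> D (u * v)%g) ->
  {in D &, {morph phi : u v / (u * v)%g}} ->
  {in D &, {morph psi : u v / (u * v)%g}} ->
  phi @` D = setT -> psi @` D = setT ->
  {in D &, forall u v, phi u = phi v <-> psi u = psi v} -> isomorphic G H.
Proof.
move=> DM phiM psiM phiS psiS E.
have inD u : D u -> u \in D by move=> Du; rewrite inE.
have /choice [g gP] : forall x, exists u, D u /\ phi u = x.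
  move=> x; have : [set: G] x by [].
  by rewrite -phiS => -[u Du <-]; exists u.
have /choice [h hP] : forall y, exists u, D u /\ psi u = y.
  move=> y; have : [set: H] y by [].
  by rewrite -psiS => -[u Du <-]; exists u.
have gD x : D (g x) by have [] := gP x.
have hD x : D (h x) by have [] := hP x.
have gE x : phi (g x) = x by have [] := gP x.
have hE x : psi (h x) = x by have [] := hP x.
exists (psi \o g).
  move=> x y /=; rewrite -psiM; try exact: inD.
  apply/E; [exact: inD|by apply/inD/DM|].
  by rewrite phiM ?gE //; apply: inD.
exists (phi \o h) => x /=.
  by rewrite -[RHS]gE; apply/E; [exact: inD|exact: inD|rewrite hE].
by rewrite -[RHS]hE; apply/E; [exact: inD|exact: inD|rewrite gE].
Qed.

(** An automorphism that commutes with [W] preserves its fixed field, and so does its inverse. *)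
Lemma gal_restrict (L : fieldType) (K : set L) (W : set (gal_group K))
    (E : set (fixed_sub W)) (g : gal_group K) :
  (forall w, W w -> (w * g)%g = (g * w)%g) ->
  (forall x, E x -> g (val x) = val x) ->
  exists h : gal_group E, forall x, val (h x) = g (val x).
Proof.
move=> Wg Eg.
have Wx (k : gal_group K) (x : fixed_sub W) :
    (forall w, W w -> (w * k)%g = (k * w)%g) -> k (val x) \in fixed_field W.
  move=> Wk; apply/asboolP => w Ww.
  have /asboolP xW := valP x.
  have -> : w (k (val x)) = (w * k)%g (val x) by [].
  by rewrite Wk //= xW.
have WgV w : W w -> (w * g^-1)%g = (g^-1 * w)%g.
  move=> Ww; apply: (can_inj (mulgK g)); apply: (can_inj (mulKg g)).
  by rewrite mulgVK !mulgA mulgV mul1g Wg.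
pose f x : fixed_sub W := Sub (g (val x)) (Wx g x Wg).
pose f' x : fixed_sub W := Sub (g^-1%g (val x)) (Wx g^-1%g x WgV).
have fK : cancel f f' by move=> x; apply: val_inj; rewrite /= gal_funK.
have f'K : cancel f' f by move=> x; apply: val_inj; rewrite /= gal_invK.
have fB : zmod_morphism f by move=> x y; apply: val_inj; rewrite /= gal_funB.
have fM : monoid_morphism f.
  by split=> [|x y]; apply: val_inj; rewrite /= ?(gal_funM g).1 ?(gal_funM g).2.
have fE x : E x -> f x = x by move=> Ex; apply: val_inj; rewrite /= Eg.
by exists (Galois fK f'K fB fM fE).
Qed.

(** Modulo [N], hence modulo [J], an element depends only on its coordinates modulo [N]. *)
Lemma finite_quotr (F : fieldExtType rat) (O : orderOf F) (J : ideal (order_ring O)) N :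
  (0 < N)%N -> ideal_set J N%:R -> finite_set [set: quotr J].
Proof.
move=> N0 JN; have [b bB bP] := lattice_basisP O.
have biO i : order_carrier O b`_i.
  have [ib|ib] := ltnP i (\dim {:F}); last first.
    by rewrite nth_default ?size_tuple //; apply: rpred0.
  by apply/bP => k; rewrite (coord_free (Ordinal ib)) ?(basis_free bB).
pose e (i : nat) : order_ring O := Sub b`_i (biO i).
pose f (c : {ffun 'I_(\dim {:F}) -> 'I_N}) :=
  quotr_pi J (\sum_(i < \dim {:F}) e i *+ c i).
apply: (sub_finite_set (B := f @` setT)); last exact/finite_image/finite_finset.
elim/quotrW => x _.
have /choice [c cE] : forall i, exists c : int, coord b i (val x) = c%:~R.
  by move=> i; apply/intrP; move: i; apply/bP; exact: order_valP.
have cN i : (`|(c i %% N%:Z)%Z|%N < N)%N.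
  have NZ : (N%:Z != 0) by rewrite -lt0n.
  rewrite -ltz_nat gez0_abs ?modz_ge0 //; exact: ltz_pmod.
exists [ffun i => Ordinal (cN i)] => //; apply/quotr_eqP.
have NJ : N%:R \in J by apply/ideal_setP; rewrite rmorph_nat.
have -> : x = \sum_(i < \dim {:F}) e i *~ c i.
  apply: val_inj; rewrite raddf_sum [LHS](coord_basis bB) ?memvf //.
  by apply: eq_bigr => i _; rewrite raddfMz cE scaler_int.
rewrite -sumrB; apply: rpred_sum => i _; rewrite ffunE /=.
have NZ : (N%:Z != 0) by rewrite -lt0n.
rewrite {2}(divz_eq (c i) N) mulrzDr pmulrn gez0_abs ?modz_ge0 //.
rewrite opprD addrCA subrr addr0 rpredN mulrC mulrzA -pmulrn -mulr_natl.
by rewrite -mulrzAr mulrC ideal_mull.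
Qed.

Section Reciprocity.
Variables (R : realType) (F : fieldExtType rat) (Fab : fieldType).
Variables (iota : {rmorphism F -> Fab}).
Variables (art : idele F R -> gal_group (range iota)) (artP : is_artin_map art).
Variables (O : orderOf F) (J : ideal (order_ring O)) (N : nat).
Hypotheses (N0 : (0 < N)%N) (JN : ideal_set J N%:R).
Local Notation U := (@congruence_ideles F R O).
Local Notation Ufull := (U (full_ideal (order_ring O))).

Lemma art1 : art 1%g = 1%g.
Proof. by apply: (mulgI (art 1%g)); rewrite -(artM artP) !mulg1. Qed.

Lemma artV s : art s^-1%g = (art s)^-1%g.
Proof. by apply: (mulgI (art s)); rewrite -(artM artP) !mulgV art1. Qed.

Lemma art_congruence_open : krull_open (art @` U J).
Proof.
apply: (art_open artP).
have := @congruence_coset_open F R O J N 1%g N0 JN.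
by congr (open _); apply/seteqP; split=> s /=; rewrite mul1g.
Qed.

(* [U J] is open, so [ker art] lies in the product of [U J] with the principal
   ideles and the connected component at infinity. *)
Lemma art_residue s a : Ufull s -> idele_residue s a ->
  (art @` U J) (art s) <-> a \in units_image (quotr_pi J).
Proof.
move=> sO sa; split=> [[t tJ ts]|/asboolP[x xa]]; last first.
  (* The principal idele [r] of the unit has the residue of [s], so [r^-1 s] lies in [U J] and has
     the same Artin image as [s]. *)
  have [r [rp rO /(_ J)]] := @order_unit_idele F R O x; rewrite xa => ra.
  exists (r^-1 * s)%g; first exact: idele_residue_eq rO sO ra sa.
  by rewrite (artM artP) artV (art_principal artP rp) invg1 mul1g.
pose k := (s * t^-1)%g.
have : [set r | art r = 1%g] k by rewrite /= /k (artM artP) artV ts mulgV.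
(* As [k] lies in a closure, its open neighbourhood [k U_J] contains a product of a principal idele
   and an element of the archimedean component. *)
rewrite (art_ker artP) => /(_ [set r | U J (k^-1 * r)%g]) [].
  apply: open_nbhs_nbhs; split; first exact: congruence_coset_open N0 JN.
  by rewrite /= mulVg; apply: congruence_ideles1.
move=> _ [[p pp [c cc <-]] /= kJ].
have [|x xs] := @principal_residue F R O J s p sO pp c cc.
  have -> : (s^-1 * (p * c) = t^-1 * (k^-1 * (p * c)))%g.
    by rewrite /k invgM invgK -!mulgA mulKg.
  by apply: congruence_idelesM => //; apply: congruence_idelesV.
apply/asboolP; exists x; exact: idele_residue_unique N0 JN xs sa.
Qed.

Lemma idele_residueV s a : Ufull s -> idele_residue (J := J) s a ->
  idele_residue s^-1%g a^-1%g.
Proof.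
move=> sO sa; have sVO := congruence_idelesV sO.
have [b sb] := idele_residue_exists N0 JN sVO.
have r1 : idele_residue (J := J) (1%g : idele F R) 1%g.
  exists 1; first by rewrite rmorph1.
  by move=> p; rewrite /= rmorph1 subrr; apply: zspan0.
have := idele_residueM sO sa sb; rewrite mulgV => /(idele_residue_unique N0 JN r1) e.
by rewrite (_ : a^-1%g = b) //; apply: (mulgI a); rewrite mulgV.
Qed.
End Reciprocity.

Theorem theorem4p6 (R : realType) (F : fieldExtType rat)
  (Fab : fieldType) (iota : {rmorphism F -> Fab})
  (FabP : maximal_abelian iota)
  (art : idele F R -> gal_group (range iota)) (artP : is_artin_map art)
  (O : orderOf F) (I : ideal (order_ring O))
  (I_neq0 : exists2 x, x \in I & x != 0) :
  isomorphic (gal_over_ring_class art I) (quotg (units_image (quotr_pi I))).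
Proof.
have [N N0 IN] := ideal_has_int I_neq0.
pose U := @congruence_ideles F R O I.
pose D := @congruence_ideles F R O (full_ideal (order_ring O)).
pose W := art @` U.
have [[alg _ galC] _] := FabP.
have DM u v : D u -> D v -> D (u * v)%g by apply: congruence_idelesM.
have DV u : D u -> D u^-1%g by apply: congruence_idelesV.
have W1 : W 1%g by exists 1%g; [exact: congruence_ideles1|exact: (art1 artP)].
have WM u v : W u -> W v -> W (u * v)%g.
  move=> [s sU <-] [t tU <-]; exists (s * t)%g; last by rewrite (artM artP).
  exact: congruence_idelesM.
(* [W] is open, so an Artin image that fixes [H_{I,O}] pointwise already lies in [W]. *)
have Wfix s : (forall x, x \in fixed_field W -> art s x = x) -> W (art s).
  move=> sfix; apply: open_subgroup_galois => //.
  - move=> x; have [f f0 fx] := alg x; exists (map_poly iota f).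
      by rewrite map_poly_eq0.
    by split=> // i; rewrite coef_map; exists f`_i.
  - exact (art_congruence_open artP N0 IN).
  by move=> x xW; apply: sfix; apply/asboolP.
(* [res] restricts [art s] to [H_{I,O}]; it takes the value 1 outside [D]. *)
have /choice [res resE] : forall s, exists h : gal_over_ring_class art I,
    D s -> forall x, val (h x) = art s (val x).
  move=> s; have [Ds|nDs] := pselect (D s); last by exists 1%g.
  have [|x xE|h hE] := @gal_restrict Fab (range iota) W
    [set x | val x \in ring_class_pred art O] (art s).
  - by move=> w _; apply: galC.
  - by have /asboolP := xE; apply; exists s.
  by exists h.
have resM : {in D &, {morph res : s t / (s * t)%g}}.
  move=> s t; rewrite !inE => Ds Dt; apply: gal_eq => x; apply: val_inj.
  by rewrite resE ?(artM artP) /= ?resE //; apply: DM.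
have res1P s : D s -> res s = 1%g <-> W (art s).
  move=> Ds; split=> [s1|Ws].
    apply: Wfix => x xW.
    have := resE s Ds (Sub x xW); rewrite s1 /= => <-; exact: erefl.
  apply: gal_eq => x; apply: val_inj; rewrite resE //.
  by have /asboolP := valP x; apply.
have res11 : res 1%g = 1%g.
  by apply/res1P; [exact: congruence_ideles1|rewrite (art1 artP)].
have resV s : D s -> res s^-1%g = (res s)^-1%g.
  move=> Ds; apply: (mulgI (res s)); rewrite mulgV -resM ?inE ?mulgV //.
  exact: DV.
have res_eqP s t : D s -> D t -> res s = res t <-> W (art (s * t^-1)%g).
  move=> Ds Dt; rewrite -res1P ?resM ?inE ?resV //; try exact: DV.
    split=> [->|st]; first by rewrite mulgV.
    by apply: (mulIg (res t)^-1%g); rewrite mulgV.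
  by apply: DM => //; apply: DV.
have /choice [rs rsE] : forall s, exists a : units (quotr I), D s -> idele_residue s a.
  move=> s; have [Ds|nDs] := pselect (D s); last by exists 1%g.
  by have [a sa] := idele_residue_exists N0 IN Ds; exists a.
have rs_unique s a : D s -> idele_residue s a -> rs s = a.
  by move=> Ds; apply: (idele_residue_unique N0 IN); apply: rsE.
have rsM s t : D s -> D t -> rs (s * t)%g = (rs s * rs t)%g.
  move=> Ds Dt; apply: rs_unique; first exact: DM.
  by apply: idele_residueM => //; apply: rsE.
have rsV s : D s -> rs s^-1%g = (rs s)^-1%g.
  move=> Ds; apply: rs_unique; first exact: DV.
  by apply: (idele_residueV N0 IN) => //; apply: rsE.
have WP s : D s -> W (art s) <-> rs s \in units_image (quotr_pi I).
  by move=> Ds; apply: (art_residue artP N0 IN) => //; apply: rsE.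
(* Ideles of [D] with equal residues have equal restrictions, so the image is indexed by the finite
   unit group of [O/I]; [t] picks an idele for each residue. *)
have res_fin : finite_set (res @` D).
  have units_fin : finite_set [set: units (quotr I)].
    rewrite (_ : setT = @uval (quotr I) @^-1` setT) //.
    apply: finite_preimage (finite_quotr N0 IN) => u v _ _; exact: uval_inj.
  have /choice [t tP] : forall a : units (quotr I),
      exists s : idele F R, D s /\ idele_residue s a.
    by move=> a; have [s Ds sa] := @idele_residue_surj F R O I N a N0 IN; exists s.
  apply: (sub_finite_set (B := (res \o t) @` setT)); last exact: finite_image.
  move=> _ [s Ds <-]; exists (rs s) => //=; have [Dt ta] := tP (rs s).
  apply/res_eqP => //; apply/WP; first by apply: DM => //; apply: DV.
  rewrite rsM ?rsV //; last exact: DV.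
  by rewrite (rs_unique _ _ Dt ta) mulgV gpred1.
have res_surj : res @` D = setT.
  apply/seteqP; split=> // s _; apply: finite_group_galois => //.
  - by exists 1%g; first exact: congruence_ideles1.
  - move=> _ _ [s' Ds' <-] [t Dt <-]; exists (s' * t)%g; first exact: DM.
    by rewrite resM ?inE.
  move=> x xfix; apply: gal_fix; apply/asboolP => _ [t Dt <-].
  by rewrite -resE // xfix //; exists t.
pose Q := quotg (units_image (quotr_pi I)).
apply: (@isomorphic_common_source _ _ Q D res (fun s => \pi_Q (rs s))%qT) => //.
- move=> s t; rewrite !inE => Ds Dt; rewrite rsM //.
  by rewrite -quotg_piM.
- apply/seteqP; split=> // q _; elim/quotW: q => a.
  have [s Ds sa] := @idele_residue_surj F R O I N a N0 IN.
  by exists s => //; rewrite (rs_unique s a).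
move=> s t; rewrite !inE => Ds Dt; rewrite res_eqP // WP ?rsM ?rsV //; try exact: DV.
  by split=> /quotg_eqP.
by apply: DM => //; apply: DV.
Qed.
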